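(* The following hold: 1. $P_{comp}(2,4)=1$. 2. $P_{non}(2,4)=3$. 3. $P(2,4)=3$ (and thus $P(n,4)=3$ for every positive integer $n$). 4. If $f$ is a $4$-nomial in two variables and $\dim\mathrm{Newt}(f)=2$, then $\mathrm{Tot}(f^{-1}(0))\le 2$.
   Context: $\mathbb{N}$ denotes the positive integers, and $\mathbb{R}_+^n = \{(x_1,\dots,x_n)\in\mathbb{R}^n : x_k>0 \text{ for } 1\le k\le n\}$. For $x\in\mathbb{R}_+^n$ and $a=(a_1,\dots,a_n)\in\mathbb{R}^n$, $x^a := x_1^{a_1}\cdots x_n^{a_n}$. For $m \in \mathbb{N}$, an $m$-nomial in $n$ variables is a function $f:\mathbb{R}_+^n\to\mathbb{R}$ of the form $f(x)=\sum_{i=1}^m c_i x^{a_i}$ with $c_i\in\mathbb{R}$, $c_i\neq 0$, and pairwise distinct exponent vectors $a_i\in\mathbb{R}^n$. The Newton polytope $\mathrm{Newt}(f)$ is the convex hull of $\{a_1,\dots,a_m\}$, and $\dim\mathrm{Newt}(f)$ is the dimension of its affine span. For $X\subset\mathbb{R}_+^n$, $\mathrm{Tot}(X)$, $\mathrm{Comp}(X)$ and $\mathrm{Non}(X)$ are the numbers of connected components, compact connected components and non-compact connected components of $X$, respectively. Let $\Omega(n,m)$ be the set of all $k$-nomials in $n$ variables with $1\le k\le m$. Then $P(n,m)$, $P_{comp}(n,m)$ and $P_{non}(n,m)$ are the maxima, over $f\in\Omega(n,m)$, of $\mathrm{Tot}(f^{-1}(0))$, $\mathrm{Comp}(f^{-1}(0))$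 and $\mathrm{Non}(f^{-1}(0))$, respectively, where $f^{-1}(0)\subset\mathbb{R}_+^n$. *)

(* Defs.v *)
From HB Require Import structures.
From mathcomp Require Import all_boot all_order all_algebra.
From mathcomp Require Import all_classical all_reals all_analysis.
Set Implicit Arguments.
Unset Strict Implicit.
Unset Printing Implicit Defensive.
Import Order.TTheory GRing.Theory Num.Theory.
Import numFieldNormedType.Exports.
Local Open Scope classical_set_scope.
Local Open Scope ring_scope.

Definition orthant (R : realType) (n : nat) : set 'rV[R]_n :=
  [set x | forall j : 'I_n, 0 < x ord0 j].

Definition monomial (R : realType) (n : nat) (a x : 'rV[R]_n) : R :=
  \prod_(j < n) (x ord0 j `^ a ord0 j).

(* A function on the positive orthant is represented by a total function whose
   values outside the orthant are unconstrained and never used. *)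
Definition nomial_repr (R : realType) (n m : nat) (c : 'I_m -> R)
    (a : 'I_m -> 'rV[R]_n) (f : 'rV[R]_n -> R) : Prop :=
  [/\ forall i, c i != 0,
      injective a
    & forall x, orthant x -> f x = \sum_(i < m) c i * monomial (a i) x].

Definition is_nomial (R : realType) (n m : nat) (f : 'rV[R]_n -> R) : Prop :=
  exists (c : 'I_m -> R) (a : 'I_m -> 'rV[R]_n), nomial_repr c a f.

Definition Omega (R : realType) (n m : nat) : set ('rV[R]_n -> R) :=
  [set f | exists2 k : nat, (1 <= k <= m)%N & is_nomial k f].

Definition zero_set (R : realType) (n : nat) (f : 'rV[R]_n -> R) :
    set 'rV[R]_n :=
  [set x | orthant x /\ f x = 0].

Definition Newt (R : realType) (n m : nat) (a : 'I_m -> 'rV[R]_n) :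
    set 'rV[R]_n :=
  smallest (@convex_set R 'rV[R]_n) (range a).

Definition affine_span (R : realType) (n : nat) (A : set 'rV[R]_n) :
    set 'rV[R]_n :=
  [set x | exists (k : nat) (t : 'I_k -> R) (v : 'I_k -> 'rV[R]_n),
     [/\ forall i, A (v i),
         \sum_(i < k) t i = 1
       & x = \sum_(i < k) t i *: v i]].

(* [A] has dimension [d]: its affine span is a translate of a linear subspace
   of dimension [d]. *)
Definition has_dim (R : realType) (n : nat) (A : set 'rV[R]_n) (d : nat) :
    Prop :=
  exists (p : 'rV[R]_n) (U : {vspace 'rV[R]_n}),
    affine_span A = [set p + u | u in [set` U]] /\ \dim U = d.

Definition components (R : realType) (n : nat) (X : set 'rV[R]_n) :
    set (set 'rV[R]_n) :=
  connected_component X @` X.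

(* [counting] is the number of elements, with value +oo on infinite sets. *)
Definition Tot (R : realType) (n : nat) (X : set 'rV[R]_n) : \bar R :=
  @counting (set 'rV[R]_n) R (components X).

Definition Comp (R : realType) (n : nat) (X : set 'rV[R]_n) : \bar R :=
  @counting (set 'rV[R]_n) R (components X `&` [set C | compact C]).

Definition Non (R : realType) (n : nat) (X : set 'rV[R]_n) : \bar R :=
  @counting (set 'rV[R]_n) R (components X `&` [set C | ~ compact C]).

Definition is_max (R : realType) (S : set \bar R) (v : \bar R) : Prop :=
  S v /\ ubound S v.

(* [is_P R n m N] states that the maximum P(n,m) exists and equals N;
   similarly for [is_Pcomp] and [is_Pnon]. *)
Definition is_P (R : realType) (n m N : nat) : Prop :=
  is_max [set Tot (zero_set f) | f in @Omega R n m] N%:R%:E.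

Definition is_Pcomp (R : realType) (n m N : nat) : Prop :=
  is_max [set Comp (zero_set f) | f in @Omega R n m] N%:R%:E.

Definition is_Pnon (R : realType) (n m N : nat) : Prop :=
  is_max [set Non (zero_set f) | f in @Omega R n m] N%:R%:E.

(* Main.v *)
(* In logarithmic coordinates the zero set of sum_i c_i x^(a_i) becomes
   Z = {y | sum_i c_i e^(a_i . y) = 0}, and we may assume that at most as many
   c_i are negative as positive.  If the a_i are collinear, Z is a union of
   parallel hyperplanes, one for each zero of a univariate exponential sum;
   there are at most m - 1 of these by Rolle's theorem.  Otherwise:
   - With one negative coefficient, Z is the level set of a convex function.
     Seen from a point where the function is smaller, it is parametrized by the
     directions in which the function is unbounded.  These form a union of open
     half-spaces, which is connected because the a_i are not collinear.
   - With signs (+,+,-,-), put s = (a_1 - a_2) . y and r = (a_3 - a_4) . y.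
     Either a translation direction fixing s and r makes Z a graph over the
     whole space, or Z is given by a separated equation Phi(s) = Psi(r) where
     Phi and Psi are sums of two exponentials.  If Phi is monotone, Z is a graph
     over {r | Psi(r) > inf Phi}, the complement of an interval.  If Phi and Psi
     both have a minimum, say min Phi <= min Psi, then Z is the union of two
     graphs over the whole r-axis.  So Z has at most two connected pieces, and
     s or r is unbounded on each of them, which excludes compact components. *)

Require Import Defs.
From HB Require Import structures.
From mathcomp Require Import all_boot all_order all_algebra.
From mathcomp Require Import all_classical all_reals all_analysis.
From mathcomp Require Import zify ring lra.
Set Implicit Arguments.
Unset Strict Implicit.
Unset Printing Implicit Defensive.
Import Order.TTheory GRing.Theory Num.Theory.
Import numFieldNormedType.Exports.
Local Open Scope classical_set_scope.
Local Open Scope ring_scope.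

(** * Continuity and connectedness in row vectors *)

Lemma cvg_rV (R : realType) n (T : Type) (F : set_system T) (f : T -> 'rV[R]_n)
    (l : 'rV[R]_n) : Filter F ->
  (forall j, f x ord0 j @[x --> F] --> l ord0 j) -> f @ F --> l.
Proof.
move=> FF fl A [P lP PA].
have : \forall x \near F, forall j, P ord0 j (f x ord0 j).
  by apply: filter_forall => j; apply: (fl j); exact: lP.
by apply: filterS => x Px; apply: PA => i j; rewrite (ord1 i).
Qed.

Lemma continuous_sum (R : realType) (T : topologicalType) m (F : 'I_m -> T -> R) :
  (forall i, continuous (F i)) -> continuous (fun x => \sum_(i < m) F i x).
Proof.
by move=> cF; apply: continuous_big => //; exact: add_continuous.
Qed.

Definition dot (R : realType) n (a y : 'rV[R]_n) : R :=
  \sum_(j < n) a ord0 j * y ord0 j.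

Section dot.
Variables (R : realType) (n : nat).
Implicit Types (a b x y : 'rV[R]_n) (k : R).

Lemma dotC a b : dot a b = dot b a.
Proof. by apply: eq_bigr => j _; rewrite mulrC. Qed.

Lemma dotDr a x y : dot a (x + y) = dot a x + dot a y.
Proof. by rewrite -big_split; apply: eq_bigr => j _; rewrite mxE mulrDr. Qed.

Lemma dotZr k a x : dot a (k *: x) = k * dot a x.
Proof. by rewrite mulr_sumr; apply: eq_bigr => j _; rewrite mxE mulrCA. Qed.

Lemma dotNr a x : dot a (- x) = - dot a x.
Proof. by rewrite -scaleN1r dotZr mulN1r. Qed.

Lemma dotBr a x y : dot a (x - y) = dot a x - dot a y.
Proof. by rewrite dotDr dotNr. Qed.

Lemma dotDl a b x : dot (a + b) x = dot a x + dot b x.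
Proof. by rewrite dotC dotDr !(dotC x). Qed.

Lemma dotZl k a x : dot (k *: a) x = k * dot a x.
Proof. by rewrite dotC dotZr dotC. Qed.

Lemma dotNl a x : dot (- a) x = - dot a x.
Proof. by rewrite dotC dotNr dotC. Qed.

Lemma dotBl a b x : dot (a - b) x = dot a x - dot b x.
Proof. by rewrite dotDl dotNl. Qed.

Lemma dot0l x : dot 0 x = 0.
Proof. by rewrite -(scale0r 0) dotZl mul0r. Qed.

Lemma dot_ge0 a : 0 <= dot a a.
Proof. by apply: sumr_ge0 => j _; rewrite -expr2 sqr_ge0. Qed.

Lemma dot_gt0 a : a != 0 -> 0 < dot a a.
Proof.
move=> a0; rewrite lt_neqAle dot_ge0 andbT eq_sym; apply: contra a0.
rewrite psumr_eq0 => [/allP a0|j _]; last by rewrite -expr2 sqr_ge0.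
apply/eqP/rowP => j; rewrite mxE; apply/eqP.
by have := a0 j (mem_index_enum j); rewrite /= mulf_eq0 orbb.
Qed.

Lemma dot_continuous a : continuous (dot a).
Proof.
rewrite /dot; apply: continuous_sum => j y.
apply: (@cvgMl_tmp _ _ (nbhs y) _ (fun M : 'rV[R]_n => M ord0 j)).
exact: (@coord_continuous R 1 n ord0 j y).
Qed.

End dot.

Lemma continuous_mulc (R : realType) (T : topologicalType) (k : R) (f : T -> R) :
  continuous f -> continuous (fun x => k * f x).
Proof. by move=> cf x; apply: cvgMl_tmp; exact: cf. Qed.

Lemma continuous_subr (R : realType) (T : topologicalType) (f g : T -> R) :
  continuous f -> continuous g -> continuous (fun x => f x - g x).
Proof. by move=> cf cg x; apply: cvgB; [exact: cf|exact: cg]. Qed.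

Lemma continuous_addr (R : realType) (T : topologicalType) (f g : T -> R) :
  continuous f -> continuous g -> continuous (fun x => f x + g x).
Proof. by move=> cf cg x; apply: cvgD; [exact: cf|exact: cg]. Qed.

Lemma continuous_expR_comp (R : realType) (T : topologicalType) (f : T -> R) :
  continuous f -> continuous (fun x => expR (f x)).
Proof. by move=> cf x; exact: continuous_comp (cf x) (@continuous_expR R _). Qed.

Lemma continuous_dot_comp (R : realType) (T : topologicalType) n
    (a : 'rV[R]_n) (f : T -> 'rV[R]_n) :
  continuous f -> continuous (fun x => dot a (f x)).
Proof. by move=> cf x; exact: continuous_comp (cf x) (@dot_continuous _ _ a _). Qed.

Lemma continuous_rV_at (R : realType) (T : topologicalType) n (f : T -> 'rV[R]_n) x :
  (forall j, continuous_at x (fun x => f x ord0 j)) -> continuous_at x f.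
Proof. by move=> cf; apply: cvg_rV => j; exact: cf. Qed.

Lemma continuous_rV (R : realType) (T : topologicalType) n (f : T -> 'rV[R]_n) :
  (forall j, continuous (fun x => f x ord0 j)) -> continuous f.
Proof. by move=> cf x; apply: continuous_rV_at => j; exact: cf. Qed.

Lemma continuous_shift_scale (R : realType) n (p : 'rV[R]_n) (t : R) :
  continuous (fun v : 'rV[R]_n => p + t *: v).
Proof.
apply: continuous_rV => j; under eq_fun do rewrite !mxE.
apply: continuous_addr; first exact: cst_continuous.
by apply: continuous_mulc; exact: coord_continuous.
Qed.

Lemma continuous_line (R : realType) n (p v : 'rV[R]_n) :
  continuous (fun t : R => p + t *: v).
Proof.
apply: continuous_rV => j; under eq_fun do rewrite !mxE.
apply: continuous_addr; first exact: cst_continuous.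
under eq_fun do rewrite mulrC.
by apply: continuous_mulc => t; exact: cvg_id.
Qed.

Definition seg_convex (R : realType) n (A : set 'rV[R]_n) :=
  forall x y t, A x -> A y -> 0 <= t -> t <= 1 -> A (x + t *: (y - x)).

Lemma seg_convex_connected (R : realType) n (A : set 'rV[R]_n) :
  seg_convex A -> connected A.
Proof.
move=> cA; have [->|/set0P[x0 Ax0]] := eqVneq A set0; first exact: connected0.
pose S (y : 'rV[R]_n) := (fun t : R => x0 + t *: (y - x0)) @` `[0, 1].
have -> : A = \bigcup_(y in A) S y.
  apply/seteqP; split => [y Ay|y [z Az [t /=]]].
    exists y => //; exists 1; first by rewrite /= in_itv /= ler01 lexx.
    by rewrite scale1r addrC subrK.
  by rewrite in_itv /= => /andP[t0 t1] <-; apply: cA.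
apply: bigcup_connected.
  exists x0 => y _; exists 0; first by rewrite /= in_itv /= lexx ler01.
  by rewrite scale0r addr0.
move=> y _; apply: connected_continuous_connected.
  exact: segment_connected.
by apply: continuous_subspaceT; exact: continuous_line.
Qed.

(** The signs of [h y0] at [rt y0 - e] and [rt y0 + e] persist for [y] near [y0], by continuity in
    [y] at these two fixed values of [t]. The sign change of [h y] then traps [rt y] between
    them. *)
Lemma continuous_root (R : realType) (T : topologicalType) (D : set T)
    (h : T -> R -> R) (rt : T -> R) :
  (forall t, continuous (h ^~ t)) ->
  (forall y t, D y -> t < rt y -> h y t < 0) ->
  (forall y t, D y -> rt y < t -> 0 < h y t) ->
  {within D, continuous rt}.
Proof.
move=> hc hneg hpos; apply/subspace_continuousP => y0 Dy0.
apply/cvgrPdist_le => e e0; rewrite /= near_withinE.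
have h1 : h y0 (rt y0 - e) < 0 by apply: hneg => //; rewrite ltrBlDr ltrDl.
have h2 : 0 < h y0 (rt y0 + e) by apply: hpos => //; rewrite ltrDl.
have n1 : \forall y \near y0, h y (rt y0 - e) < 0.
  exact: (cvgr_lt _ (hc (rt y0 - e) y0) _ h1).
have n2 : \forall y \near y0, 0 < h y (rt y0 + e).
  exact: (cvgr_gt _ (hc (rt y0 + e) y0) _ h2).
near=> y; move=> Dy.
have a1 : h y (rt y0 - e) < 0 by near: y.
have a2 : 0 < h y (rt y0 + e) by near: y.
rewrite ler_distlC; apply/andP; split; rewrite leNgt; apply/negP => lt.
  by have := hpos _ _ Dy lt; rewrite ltNge (ltW a1).
by have := hneg _ _ Dy lt; rewrite ltNge (ltW a2).
Unshelve. all: by end_near. Qed.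

(** This is the tool for every later connectedness claim about a graph: a solution set is
    parametrized by moving each point [base y] of a connected family along [dir y] up to the unique
    sign change of [h y]. *)
Lemma connected_roots (R : realType) n (T : topologicalType) (D : set T)
    (h : T -> R -> R) (rt : T -> R) (base dir : T -> 'rV[R]_n) :
  connected D -> continuous base -> continuous dir ->
  (forall t, continuous (h ^~ t)) ->
  (forall y t, D y -> t < rt y -> h y t < 0) ->
  (forall y t, D y -> rt y < t -> 0 < h y t) ->
  connected [set base y + rt y *: dir y | y in D].
Proof.
move=> cD cb cd hc hneg hpos; apply: connected_continuous_connected => //.
have crt := continuous_root hc hneg hpos.
apply/subspace_continuousP => y Dy; apply: cvg_rV => j.
rewrite !mxE; under eq_fun do rewrite !mxE.
have coord (g : T -> 'rV[R]_n) : continuous g ->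
    g x ord0 j @[x --> within D (nbhs y)] --> g y ord0 j.
  move=> cg; apply: cvg_trans (cvg_app _ (cvg_within _)) _.
  by apply: (cvg_comp _ (fun M : 'rV[R]_n => M ord0 j) (cg y)); exact: coord_continuous.
apply: cvgD; first exact: coord.
by apply: cvgM; [move/subspace_continuousP: crt; exact|exact: coord].
Qed.

(** * One negative coefficient *)

Section exponentials.
Variable R : realType.

Lemma expR_tangent (m x : R) : expR m * (1 + (x - m)) <= expR x.
Proof.
rewrite -[leRHS](_ : expR m * expR (x - m) = _); last by rewrite -expRD; congr expR; ring.
by rewrite ler_wpM2l ?expR_ge0 ?expR_ge1Dx.
Qed.

(** The tangent at the intermediate point [m] lies below the exponential at both [x] and [y], and
    the weighted mean of the two tangent values is exactly [expR m]. *)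
Lemma expR_convex (x y t : R) : 0 <= t -> t <= 1 ->
  expR (x + t * (y - x)) <= (1 - t) * expR x + t * expR y.
Proof.
move=> t0 t1; set m := x + t * (y - x).
have hx : (1 - t) * (expR m * (1 + (x - m))) <= (1 - t) * expR x.
  by rewrite ler_wpM2l ?subr_ge0 ?expR_tangent.
have hy : t * (expR m * (1 + (y - m))) <= t * expR y.
  by rewrite ler_wpM2l ?expR_tangent.
apply: le_trans (lerD hx hy); rewrite le_eqVlt; apply/orP; left; apply/eqP.
by rewrite {3 5}/m; ring.
Qed.

End exponentials.

(** The relation is not symmetric at zero: 0 is parallel to every vector, but only 0 is parallel to
    0. *)
Definition parallel (R : realType) n (u v : 'rV[R]_n) :=
  exists k : R, u = k *: v.

Lemma parallel_sym (R : realType) n (u v : 'rV[R]_n) :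
  u != 0 -> parallel u v -> parallel v u.
Proof.
move=> u0 [k ukv]; have k0 : k != 0.
  by apply: contraNneq u0 => k0; rewrite ukv k0 scale0r.
by exists k^-1; rewrite ukv scalerA mulVf // scale1r.
Qed.

Lemma parallel_trans (R : realType) n (u v w : 'rV[R]_n) :
  parallel u v -> parallel v w -> parallel u w.
Proof. by move=> [k ->] [l ->]; exists (k * l); rewrite scalerA. Qed.

(* The witness is the bisector |v| u + |u| v. *)
Lemma half_spaces_meet (R : realType) n (u v : 'rV[R]_n) :
  u != 0 -> v != 0 -> ~ parallel u v ->
  exists w, 0 < dot u w /\ 0 < dot v w.
Proof.
move=> u0 v0 uv.
pose p := Num.sqrt (dot u u); pose q := Num.sqrt (dot v v).
have p0 : 0 < p by rewrite sqrtr_gt0 dot_gt0.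
have q0 : 0 < q by rewrite sqrtr_gt0 dot_gt0.
have pp : dot u u = p * p by rewrite -expr2 sqr_sqrtr // dot_ge0.
have qq : dot v v = q * q by rewrite -expr2 sqr_sqrtr // dot_ge0.
pose w := q *: u + p *: v.
have w0 : w != 0.
  apply: contra_notN uv => /eqP w0; exists (- (p / q)).
  apply: (scalerI (lt0r_neq0 q0)); apply/eqP; rewrite scalerA -subr_eq0.
  by rewrite mulrN mulrCA divff ?lt0r_neq0 // mulr1 scaleNr opprK -/w w0.
(* With [d] the product of [u] and [v], the square of [w] is 2pq(pq + d), while the products of [w]
   with [u] and [v] are p(pq + d) and q(pq + d). So all three have the sign of pq + d. *)
have := dot_gt0 w0; rewrite {2}/w !dotDr !dotZr /w !dotDl !dotZl (dotC v u) pp qq.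
set d := dot u v => h.
have {}h : 0 < 2 * p * q * (p * q + d) by lra.
have pqd : 0 < p * q + d.
  by rewrite pmulr_rgt0 in h => //; rewrite !mulr_gt0.
exists w; rewrite /w !dotDr !dotZr (dotC v u) pp qq -/d; split.
  by have := mulr_gt0 p0 pqd; lra.
by have := mulr_gt0 q0 pqd; lra.
Qed.

Section one_negative_coefficient.
Variables (R : realType) (n m : nat) (P : pred 'I_m) (c : 'I_m -> R).
Variables (mu : 'I_m -> 'rV[R]_n) (K : R).
Hypothesis c0 : forall i, P i -> 0 < c i.

Let g y := \sum_(i < m | P i) c i * expR (dot (mu i) y).

Let g_convex x y t : 0 <= t -> t <= 1 ->
  g (x + t *: (y - x)) <= (1 - t) * g x + t * g y.
Proof.
move=> t0 t1; rewrite !mulr_sumr -big_split; apply: ler_sum => i Pi /=.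
rewrite !(mulrCA _ (c i)) -mulrDr; apply: ler_wpM2l; first exact/ltW/c0.
by rewrite dotDr dotZr dotBr expR_convex.
Qed.

Let g_continuous (T : topologicalType) (f : T -> 'rV[R]_n) :
  continuous f -> continuous (g \o f).
Proof.
move=> cf; rewrite /g /=; under eq_fun do rewrite /= big_mkcond.
apply: continuous_sum => i; case: (P i); last exact: cst_continuous.
by apply: continuous_mulc; apply: continuous_expR_comp; exact: continuous_dot_comp.
Qed.

Let Theta := \bigcup_(i in P) [set v : 'rV[R]_n | 0 < dot (mu i) v].

(** The half-spaces of [mu i] and [mu j] meet. Any other [mu k] is non-parallel to at least one of
    the two, so its half-space meets their union. *)
Let Theta_connected i j : P i -> P j -> (forall i, P i -> mu i != 0) ->
  ~ parallel (mu i) (mu j) -> connected Theta.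
Proof.
move=> Pi Pj mu0 ij.
pose H k := [set v : 'rV[R]_n | 0 < dot (mu k) v].
have cH k : connected (H k).
  apply: seg_convex_connected => x y t /= hx hy t0 t1.
  rewrite /H /= in hx hy *; rewrite dotDr dotZr dotBr; nra.
have meet k l : P k -> P l -> ~ parallel (mu k) (mu l) -> H k `&` H l !=set0.
  by move=> Pk Pl /(half_spaces_meet (mu0 _ Pk) (mu0 _ Pl))[w [? ?]]; exists w.
have [p [pi pj]] := meet _ _ Pi Pj ij.
pose B k := H k `|` (H i `|` H j).
have -> : Theta = \bigcup_(k in P) B k.
  apply/seteqP; split => [v [k Pk kv]|v [k Pk [kv|[iv|jv]]]].
  - by exists k => //; left.
  - by exists k.
  - by exists i.
  - by exists j.
have cij : connected (H i `|` H j) by apply: connectedU => //; exists p.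
apply: bigcup_connected; first by exists p => k Pk; right; left.
move=> k Pk; apply: connectedU => //.
have [ki|nki] := pselect (parallel (mu k) (mu i)); last first.
  by have [w [w1 w2]] := meet _ _ Pk Pi nki; exists w; split => //; left.
have nkj : ~ parallel (mu k) (mu j).
  by move=> kj; apply: ij; apply: parallel_trans kj; apply: parallel_sym => //; exact: mu0.
by have [w [w1 w2]] := meet _ _ Pk Pj nkj; exists w; split => //; right.
Qed.

(* When the sublevel set [g <= K] has an interior point [p], its boundary is
   radially parametrized from [p] by the directions in which [g] is unbounded;
   these form the union [Theta] of half-spaces. *)
Lemma one_negative_connected i j : P i -> P j ->
  (forall i, P i -> mu i != 0) -> ~ parallel (mu i) (mu j) ->
  connected [set y | g y = K].
Proof.
move=> Pi Pj mu0 ij.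
(* If [g] never drops below [K], the level set is the set where a convex function attains its
   minimum, or is empty; either way it is convex. *)
have [[p gp]|noint] := pselect (exists p, g p < K); last first.
  have gK y : K <= g y by rewrite leNgt; apply/negP => ?; apply: noint; exists y.
  apply: seg_convex_connected => x y t /= hx hy t0 t1.
  apply/eqP; rewrite eq_le gK andbT (le_trans (g_convex _ _ t0 t1)) // hx hy.
  by rewrite -mulrDl subrK mul1r.
have below v t u : 0 <= t -> t < u -> g (p + u *: v) = K -> g (p + t *: v) < K.
  move=> t0 tu gu; have u0 : 0 < u by exact: le_lt_trans tu.
  have := @g_convex p (p + u *: v) (t / u).
  rewrite addrAC subrr add0r scalerA divfK ?lt0r_neq0 // gu.
  move=> /(_ (divr_ge0 t0 (ltW u0))); rewrite ler_pdivrMr // mul1r => /(_ (ltW tu)) h.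
  apply: le_lt_trans h _; have : t / u < 1 by rewrite ltr_pdivrMr // mul1r.
  nra.
have above v t u : 0 <= t -> t < u -> g (p + t *: v) = K -> K < g (p + u *: v).
  move=> t0 tu gt; have u0 : 0 < u by exact: le_lt_trans tu.
  rewrite ltNge; apply/negP => gu.
  have := @g_convex p (p + u *: v) (t / u).
  rewrite addrAC subrr add0r scalerA divfK ?lt0r_neq0 // gt.
  move=> /(_ (divr_ge0 t0 (ltW u0))); rewrite ler_pdivrMr // mul1r => /(_ (ltW tu)).
  have : t / u < 1 by rewrite ltr_pdivrMr // mul1r.
  have : 0 <= t / u by rewrite divr_ge0 // ltW.
  nra.
have root v : Theta v -> exists t, 0 <= t /\ g (p + t *: v) = K.
  move=> [k Pk /= kv].
  pose e := c k * expR (dot (mu k) p).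
  have e0 : 0 < e by rewrite mulr_gt0 ?c0 ?expR_gt0.
  (* Since exp(u) >= 1 + u, the term of index [k] alone is at least e T (mu_k . v), hence at least
     [K], at [p + T *: v]. The remaining terms are nonnegative. *)
  pose T := Num.max 0 (K / (e * dot (mu k) v)).
  have T0 : 0 <= T by rewrite le_max lexx.
  have gT : K <= g (p + T *: v).
    rewrite /g (bigD1 k) //=; apply: ler_wpDr.
      by apply: sumr_ge0 => l /andP[Pl _]; rewrite mulr_ge0 ?expR_ge0 // ltW ?c0.
    rewrite dotDr dotZr expRD mulrA -/e.
    have TK : K <= e * (T * dot (mu k) v).
      have ed0 : 0 < e * dot (mu k) v by exact: mulr_gt0.
      have : K / (e * dot (mu k) v) <= T by rewrite /T le_max lexx orbT.
      by rewrite ler_pdivrMr // mulrCA.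
    apply: (le_trans TK); rewrite ler_pM2l //.
    by apply: le_trans (expR_ge1Dx _); lra.
  have [||t tT gt] := @IVT R (fun t => g (p + t *: v)) 0 T K T0.
  - apply: continuous_subspaceT; apply: g_continuous.
    exact: continuous_line.
  - by rewrite /= scale0r addr0 ge_min (ltW gp) /= le_max gT orbT.
  by exists t; split => //; move: tT; rewrite in_itv /= => /andP[].
pose rt v := xget 0 [set t | 0 <= t /\ g (p + t *: v) = K].
have rtP v : Theta v -> 0 <= rt v /\ g (p + rt v *: v) = K.
  by move=> /root [t tP]; rewrite /rt; case: xgetP => [_ -> //|/(_ t)].
have -> : [set y | g y = K] = [set p + rt v *: v | v in Theta].
  apply/seteqP; split => [y /= gy|y [v /rtP[_ h] <-] //].
  (* Otherwise no exponent increases from [p] to [y], so [g y <= g p < K]. *)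
  have Ty : Theta (y - p).
    apply: contrapT => nT; suff : g y <= g p by rewrite gy leNgt gp.
    apply: ler_sum => k Pk; apply: ler_wpM2l; first exact/ltW/c0.
    rewrite ler_expR -subr_ge0 -opprB oppr_ge0 -dotBr leNgt; apply/negP => h.
    by apply: nT; exists k.
  exists (y - p) => //; have [r0 rK] := rtP _ Ty.
  have g1 : g (p + 1 *: (y - p)) = K by rewrite scale1r addrC subrK.
  have -> : rt (y - p) = 1.
    apply/eqP; rewrite eq_le !leNgt; apply/andP; split; apply/negP => h.
      by have := below _ _ _ ler01 h rK; rewrite g1 ltxx.
    by have := below _ _ _ r0 h g1; rewrite rK ltxx.
  by rewrite scale1r addrC subrK.
(* Behind [p] the function may exceed [K] again. Setting [h] to -1 for negative [t] leaves a single
   sign change on the whole line. *)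
pose h v t := if t < 0 then -1 else g (p + t *: v) - K.
apply: (@connected_roots R n _ Theta h rt (fun=> p) id).
- exact: Theta_connected ij.
- exact: cst_continuous.
- by move=> ?; exact: cvg_id.
- move=> t; rewrite /h; case: (t < 0); first exact: cst_continuous.
  apply: continuous_subr; last exact: cst_continuous.
  exact: (g_continuous (@continuous_shift_scale R n p t)).
- move=> v t Tv tr; rewrite /h; case: (ltP t 0) => [_|t0]; first by rewrite ltrN10.
  by rewrite subr_lt0; apply: (below v _ _ t0 tr); case: (rtP _ Tv).
- move=> v t Tv tr; have [r0 rK] := rtP _ Tv.
  rewrite /h; case: (ltP t 0) => [t0|_].
    by have := lt_le_trans (lt_trans tr t0) r0; rewrite ltxx.
  rewrite subr_gt0.
  exact: (above v _ _ r0 tr rK).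
Qed.

End one_negative_coefficient.

(** * Two positive and two negative coefficients *)

(** Unboundedness is witnessed by a linear form because such a form, composed with the
    coordinatewise logarithm, is continuous on the orthant and can be tested against compact sets
    there. *)
Definition unbounded (R : realType) n (Z : set 'rV[R]_n) :=
  exists l : 'rV[R]_n, forall M : R, exists2 y, Z y & M < `|dot l y|.

(** The pieces may be empty or overlap; they bound the number of components from above, and their
    unboundedness excludes compact components. *)
Definition two_pieces (R : realType) n (Z : set 'rV[R]_n) :=
  exists Z1 Z2, [/\ connected Z1 /\ (Z1 = set0 \/ unbounded Z1),
    connected Z2 /\ (Z2 = set0 \/ unbounded Z2) & Z = Z1 `|` Z2].

Definition bi (R : realType) (P Q a b x : R) := P * expR (a * x) + Q * expR (b * x).

Section bi.
Variable R : realType.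
Implicit Types P Q a b x w : R.

Lemma biC P Q a b x : bi P Q a b x = bi Q P b a x.
Proof. exact: addrC. Qed.

Lemma biN P Q a b x : bi P Q a b (- x) = bi P Q (- a) (- b) x.
Proof. by rewrite /bi !mulNr !mulrN. Qed.

Lemma bi_gt0 P Q a b x : 0 < P -> 0 < Q -> 0 < bi P Q a b x.
Proof. by move=> P0 Q0; rewrite addr_gt0 // mulr_gt0 ?expR_gt0. Qed.

Lemma bi_continuous P Q a b : continuous (bi P Q a b).
Proof.
rewrite /bi; apply: (@continuous_addr R R); apply: continuous_mulc;
  apply: continuous_expR_comp; apply: continuous_mulc => x; exact: cvg_id.
Qed.

Lemma bi_sublevel_convex P Q a b x y z w : 0 < P -> 0 < Q ->
  x <= y -> y <= z -> bi P Q a b x <= w -> bi P Q a b z <= w ->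
  bi P Q a b y <= w.
Proof.
move=> P0 Q0 xy yz xw zw.
have [xz|xz] := eqVneq x z.
  by have -> : y = x by apply/eqP; rewrite eq_le xy xz yz.
have xz0 : 0 < z - x by rewrite subr_gt0 lt_neqAle xz (le_trans xy).
pose t := (y - x) / (z - x).
have t0 : 0 <= t by apply: divr_ge0; [rewrite subr_ge0|exact: ltW].
have t1 : t <= 1 by rewrite ler_pdivrMr // mul1r lerD2r.
have ye k : k * y = k * x + t * (k * z - k * x).
  by rewrite /t; field; rewrite gt_eqF.
have ha := expR_convex (a * x) (a * z) t0 t1.
have hb := expR_convex (b * x) (b * z) t0 t1.
rewrite -!ye in ha hb.
have := lerD (ler_wpM2l (ltW P0) ha) (ler_wpM2l (ltW Q0) hb).
rewrite -/(bi P Q a b y) => /le_trans; apply.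
rewrite [leLHS](_ : _ = (1 - t) * bi P Q a b x + t * bi P Q a b z); last by rewrite /bi; ring.
rewrite [leRHS](_ : _ = (1 - t) * w + t * w); last by ring.
by rewrite lerD // ler_wpM2l // subr_ge0.
Qed.

Lemma bi_increasing P Q a b x y : 0 < P -> 0 < Q -> 0 < a -> 0 <= b ->
  x < y -> bi P Q a b x < bi P Q a b y.
Proof.
move=> P0 Q0 a0 b0 xy; apply: ltr_leD; first by rewrite ltr_pM2l // ltr_expR ltr_pM2l.
by rewrite ler_pM2l // ler_expR ler_wpM2l // ltW.
Qed.

Lemma bi_reaches P Q a b x w : 0 < P -> 0 < Q -> 0 < a -> bi P Q a b x <= w ->
  exists2 y, x <= y & bi P Q a b y = w.
Proof.
move=> P0 Q0 a0 xw.
(* From exp(aT) >= 1 + aT, the first summand at [T] is at least P + PaT, which exceeds [w]. *)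
pose T := Num.max x (w / (P * a)).
have xT : x <= T by rewrite /T le_max lexx.
have wT : w <= bi P Q a b T.
  have h : w / (P * a) <= T by rewrite /T le_max lexx orbT.
  rewrite ler_pdivrMr ?mulr_gt0 // in h.
  have h1 : P * (1 + a * T) <= P * expR (a * T) by rewrite ler_pM2l // expR_ge1Dx.
  have h2 : 0 < Q * expR (b * T) by rewrite mulr_gt0 ?expR_gt0.
  rewrite /bi; lra.
have [||y] := @IVT R (bi P Q a b) x T w xT.
- by apply: continuous_subspaceT; exact: bi_continuous.
- by rewrite ge_min xw /= le_max wT orbT.
by rewrite in_itv /= => /andP[xy _] yw; exists y.
Qed.

Lemma bi_small P Q a b w : 0 < P -> 0 < Q -> 0 < b -> b < a -> 0 < w ->
  exists x, bi P Q a b x <= w.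
Proof.
move=> P0 Q0 b0 ba w0.
(* For x <= 0 the larger exponent gives the smaller exponential, so the sum is at most (P + Q)
   exp(bx), and the second bound on [x] makes this at most [w]. *)
pose x := Num.min 0 (ln (w / (P + Q)) / b).
have x0 : x <= 0 by rewrite /x ge_min lexx.
have bx : b * x <= ln (w / (P + Q)).
  have : x <= ln (w / (P + Q)) / b by rewrite /x ge_min lexx orbT.
  by rewrite ler_pdivlMr // mulrC.
have ax : a * x <= b * x by rewrite ler_wnM2r // ltW.
have PQ : 0 < P + Q by rewrite addr_gt0.
have e : expR (b * x) <= w / (P + Q).
  by rewrite -(@lnK _ (w / (P + Q))) ?ler_expR // posrE divr_gt0.
rewrite ler_pdivlMr // in e.
exists x; rewrite /bi; have h : expR (a * x) <= expR (b * x) by rewrite ler_expR.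
have := ler_wpM2l (ltW P0) h; lra.
Qed.

(** The point [x0] is the critical point, where exp((a - b) x0) = - Qb / (Pa). [crit] factors the
    derivative so that its sign is that of x - x0, and [key] is strict convexity in tangent form,
    which turns this sign into strict monotonicity on either side. *)
Lemma bi_valley P Q a b : 0 < P -> 0 < Q -> 0 < a -> b < 0 ->
  exists x0, (forall x y, x0 <= x -> x < y -> bi P Q a b x < bi P Q a b y) /\
             (forall x y, y <= x0 -> x < y -> bi P Q a b y < bi P Q a b x).
Proof.
move=> P0 Q0 a0 b0.
pose e := - (Q * b) / (P * a).
have e0 : 0 < e by rewrite divr_gt0 ?mulr_gt0 // oppr_gt0 pmulr_rlt0.
pose x0 := ln e / (a - b).
have ab : 0 < a - b by rewrite subr_gt0 (lt_trans b0).
have crit x : P * a * expR (a * x) + Q * b * expR (b * x) =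
    P * a * expR (b * x) * (expR ((a - b) * x) - expR ((a - b) * x0)).
  have -> : expR ((a - b) * x0) = e.
    by rewrite mulrC divfK ?gt_eqF // lnK.
  have -> : expR (a * x) = expR (b * x) * expR ((a - b) * x).
    by rewrite -expRD; congr expR; ring.
  by rewrite /e; field; rewrite !gt_eqF.
have key x y : x != y -> bi P Q a b x - bi P Q a b y <
    (P * a * expR (a * x) + Q * b * expR (b * x)) * (x - y).
  move=> xy.
  have h k : k != 0 -> expR (k * x) * (1 + k * (y - x)) < expR (k * y).
    move=> k0; rewrite -[ltRHS](_ : expR (k * x) * expR (k * (y - x)) = _).
      rewrite ltr_pM2l ?expR_gt0 // expR_gt1Dx // mulf_neq0 // subr_eq0 eq_sym //.
    by rewrite -expRD; congr expR; ring.
  have ha := h a (lt0r_neq0 a0); have hb := h b (ltr0_neq0 b0).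
  rewrite -(ltr_pM2l P0) in ha; rewrite -(ltr_pM2l Q0) in hb.
  rewrite /bi; lra.
have pos x : 0 < P * a * expR (b * x) by rewrite !mulr_gt0 ?expR_gt0.
exists x0; split => x y.
  move=> x0x xy; rewrite -subr_lt0; apply: (lt_le_trans (key _ _ (negbT (lt_eqF xy)))).
  rewrite crit; apply: mulr_ge0_le0; last by rewrite subr_le0 ltW.
  by rewrite mulr_ge0 ?(ltW (pos _)) // subr_ge0 ler_expR ler_pM2l.
move=> yx0 xy; rewrite -subr_lt0; apply: (lt_le_trans (key _ _ (negbT (gt_eqF xy)))).
rewrite crit; apply: mulr_le0_ge0; last by rewrite subr_ge0 ltW.
by rewrite mulr_ge0_le0 ?(ltW (pos _)) // subr_le0 ler_expR ler_pM2l.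
Qed.

End bi.

Section separated.
Variables (R : realType) (n : nat).
Implicit Types (s r v : 'rV[R]_n) (I J : set R).

(* The solution set is a graph over the slice [s = 0]. *)
Lemma branch_connected (Phi Psi : R -> R) s r v I J :
  dot s v = 1 -> dot r v = 0 -> is_interval I ->
  (forall x y, J x -> x < y -> J y) ->
  (forall x y, J x -> x < y -> Phi x < Phi y) ->
  continuous Psi ->
  (forall z, I z -> exists2 x, J x & Phi x = Psi z) ->
  connected [set y | [/\ Phi (dot s y) = Psi (dot r y), I (dot r y) & J (dot s y)]].
Proof.
move=> sv rv itvI upJ inc cPsi root.
pose D := [set y | dot s y = 0 /\ I (dot r y)].
pose rt y := xget 0 [set x | J x /\ Phi x = Psi (dot r y)].
have rtP y : D y -> J (rt y) /\ Phi (rt y) = Psi (dot r y).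
  by move=> [_ /root [x xJ xP]]; rewrite /rt; case: xgetP => [_ -> //|/(_ x)]; case.
(* As [J] is closed upwards, points outside it lie below the root, and the value -1 there agrees
   with the negative side. *)
pose h y x := if `[< J x >] then Phi x - Psi (dot r y) else -1.
have -> : [set y | [/\ Phi (dot s y) = Psi (dot r y), I (dot r y) & J (dot s y)]]
   = [set y + rt y *: v | y in D].
  apply/seteqP; split => y /=.
    move=> [yZ yI yJ]; have Dy : D (y - dot s y *: v).
      by split; rewrite dotBr dotZr ?sv ?rv ?mulr1 ?mulr0 ?subrr ?subr0.
    exists (y - dot s y *: v) => //; have [rJ] := rtP _ Dy.
    rewrite dotBr dotZr rv mulr0 subr0 -yZ => rP.
    suff -> : rt (y - dot s y *: v) = dot s y by rewrite subrK.
    apply/eqP; rewrite eq_le !leNgt; apply/andP; split; apply/negP => lt.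
      by have := inc _ _ yJ lt; rewrite rP ltxx.
    by have := inc _ _ rJ lt; rewrite rP ltxx.
  move=> [x Dx <-]; have [rJ rP] := rtP _ Dx; have [sx Ix] := Dx.
  by rewrite !dotDr !dotZr sv rv mulr0 addr0 mulr1 sx add0r.
apply: (@connected_roots R n _ D h rt id (fun=> v)).
- apply: seg_convex_connected => x y t [sx Ix] [sy Iy] t0 t1; split.
    by rewrite dotDr dotZr dotBr sx sy subrr mulr0 addr0.
  rewrite dotDr dotZr dotBr.
  have [xy|yx] := leP (dot r x) (dot r y).
    by apply: (itvI _ _ Ix Iy); apply/andP; split; nra.
  by apply: (itvI _ _ Iy Ix); apply/andP; split; nra.
- by move=> ?; exact: cvg_id.
- exact: cst_continuous.
- move=> x; rewrite /h; case: `[< J x >]; last exact: cst_continuous.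
  apply: continuous_subr; first exact: cst_continuous.
  move=> y; exact: continuous_comp (@dot_continuous _ _ r y) (cPsi _).
- move=> y x Dy xr; rewrite /h; case: asboolP => [xJ|_]; last exact: ltrN10.
  by rewrite subr_lt0; have [_ rP] := rtP _ Dy; rewrite -rP; exact: inc.
- move=> y x Dy rx; have [rJ rP] := rtP _ Dy; rewrite /h asboolT ?subr_gt0; last exact: upJ rx.
  by rewrite -rP; exact: inc.
Qed.

End separated.

Section two_by_two.
Variables (R : realType) (n : nat).
Implicit Types (s r v w : 'rV[R]_n) (P Q a b : R).

Lemma unbounded_of_values (Z : set 'rV[R]_n) (I : set R) r :
  (forall z, I z -> exists2 y, Z y & dot r y = z) ->
  (forall M, exists2 z, I z & M < `|z|) -> unbounded Z.
Proof.
by move=> ZI IM; exists r => M; have [z /ZI[y Zy <-] Mz] := IM M; exists y.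
Qed.

Lemma bi_bi_values (Phi Psi : R -> R) s r v w (I J : set R) z :
  dot s v = 1 -> dot r v = 0 -> dot s w = 0 -> dot r w = 1 -> I z ->
  (exists2 x, J x & Phi x = Psi z) ->
  exists2 y, [/\ Phi (dot s y) = Psi (dot r y), I (dot r y) & J (dot s y)] & dot r y = z.
Proof.
move=> sv rv sw rw Iz [x Jx e]; exists (x *: v + z *: w).
  by rewrite !dotDr !dotZr sv rv sw rw !mulr0 !mulr1 addr0 add0r.
by rewrite !dotDr !dotZr rv rw mulr0 mulr1 add0r.
Qed.

Let solutions s r P Q a b P' Q' c d :=
  [set y | bi P Q a b (dot s y) = bi P' Q' c d (dot r y)].

(** [Phi] is increasing and unbounded above, with infimum 0 if b > 0 and [Q] if b = 0. In the first
    case every positive value is reached, so the solutions form one graph. In the second only the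
    [z] with [Psi z > Q] contribute; since the set where [Psi <= Q] is an interval, cutting at one
    of its points [z0] leaves two rays [I1] and [I2], each empty or unbounded. *)
Lemma monotone_pieces s r v w P Q a b P' Q' c d :
  dot s v = 1 -> dot r v = 0 -> dot s w = 0 -> dot r w = 1 ->
  0 < P -> 0 < Q -> 0 < P' -> 0 < Q' -> 0 <= b -> b < a ->
  connected (solutions s r P Q a b P' Q' c d) \/
  two_pieces (solutions s r P Q a b P' Q' c d).
Proof.
move=> sv rv sw rw P0 Q0 P'0 Q'0 b0 ba; have a0 : 0 < a by exact: le_lt_trans ba.
set Phi := bi P Q a b; set Psi := bi P' Q' c d.
have branch (I : set R) : is_interval I ->
    (forall z, I z -> exists2 x, True & Phi x = Psi z) ->
    connected [set y | [/\ Phi (dot s y) = Psi (dot r y), I (dot r y) & True]].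
  move=> itvI root; apply: (branch_connected (v := v) (J := fun=> True)) => //.
    by move=> x y _; exact: bi_increasing.
  exact: bi_continuous.
have all_roots : (forall z, exists2 x, True & Phi x = Psi z) ->
    connected (solutions s r P Q a b P' Q' c d).
  move=> root; have := branch setT; rewrite (_ : mkset _ = solutions s r P Q a b P' Q' c d).
    by apply => //.
  by apply/seteqP; split => y /=; [case|].
(* The case b > 0 comes first. *)
move: b0; rewrite le_eqVlt => /predU1P[b0|b0]; last first.
  left; apply: all_roots => z.
  have [x xz] := bi_small P0 Q0 b0 ba (bi_gt0 c d z P'0 Q'0).
  by have [y _ yz] := bi_reaches P0 Q0 a0 xz; exists y.
have PhiE x : Phi x = P * expR (a * x) + Q by rewrite /Phi /bi -b0 mul0r expR0 mulr1.
have root z : Q < Psi z -> exists2 x, True & Phi x = Psi z.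
  move=> Qz; exists (ln ((Psi z - Q) / P) / a) => //; rewrite PhiE.
  rewrite (mulrC a) divfK ?gt_eqF // lnK ?posrE ?divr_gt0 ?subr_gt0 //.
  by rewrite (mulrC P) divfK ?gt_eqF // subrK.
have QPhi x : Q < Phi x by rewrite PhiE ltrDr mulr_gt0 ?expR_gt0.
have [[z0 z0Q]|noz] := pselect (exists z, Psi z <= Q); last first.
  by left; apply: all_roots => z; apply: root; rewrite ltNge; apply/negP => ?; apply: noz; exists z.
right; pose I1 := [set z | z < z0 /\ Q < Psi z]; pose I2 := [set z | z0 < z /\ Q < Psi z].
have down z z' : I1 z -> z' < z -> I1 z'.
  move=> [zz0 Qz] z'z; split; first exact: lt_trans zz0.
  rewrite ltNge; apply/negP => h; move: Qz; rewrite ltNge => /negP; apply.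
  by apply: (bi_sublevel_convex P'0 Q'0 (ltW z'z) (ltW zz0)).
have up z z' : I2 z -> z < z' -> I2 z'.
  move=> [zz0 Qz] z'z; split; first exact: lt_trans zz0 _.
  rewrite ltNge; apply/negP => h; move: Qz; rewrite ltNge => /negP; apply.
  by apply: (bi_sublevel_convex P'0 Q'0 (ltW zz0) (ltW z'z)).
have piece (I : set R) : is_interval I -> (forall z, I z -> Q < Psi z) ->
    (forall z, I z -> forall M, exists2 z', I z' & M < `|z'|) ->
  let Z := [set y | [/\ Phi (dot s y) = Psi (dot r y), I (dot r y) & True]] in
  connected Z /\ (Z = set0 \/ unbounded Z).
  move=> itvI IQ Iunb Z; split; first by apply: branch => // z /IQ; exact: root.
  have [->|/set0P[y [_ Iy _]]] := eqVneq Z set0; [by left|right].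
  apply: (@unbounded_of_values Z I r); last exact: Iunb Iy.
  by move=> z Iz; apply: (bi_bi_values (J := fun=> True) sv rv sw rw Iz); apply: root; exact: IQ.
exists [set y | [/\ Phi (dot s y) = Psi (dot r y), I1 (dot r y) & True]],
       [set y | [/\ Phi (dot s y) = Psi (dot r y), I2 (dot r y) & True]].
split.
- apply: piece.
  + move=> x y Ix Iy z /andP[xz]; rewrite le_eqVlt => /predU1P[->//|zy].
    exact: down Iy zy.
  + by move=> z [].
  + move=> z Iz M; exists (Num.min z (- M) - 1).
      apply: (down z) => //; apply: lt_le_trans (_ : Num.min z (- M) <= _).
        by rewrite ltrBlDr ltrDl.
      by rewrite ge_min lexx.
    have : Num.min z (- M) <= - M by rewrite ge_min lexx orbT.
    by move=> h; rewrite -normrN (lt_le_trans _ (ler_norm _)) //; lra.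
- apply: piece.
  + move=> x y Ix Iy z /andP[]; rewrite le_eqVlt => /predU1P[<-//|xz] _.
    exact: up Ix xz.
  + by move=> z [].
  + move=> z Iz M; exists (Num.max z M + 1).
      apply: (up z) => //; apply: le_lt_trans (_ : _ <= Num.max z M) _.
        by rewrite le_max lexx.
      by rewrite ltrDl.
    have : M <= Num.max z M by rewrite le_max lexx orbT.
    by move=> h; rewrite (lt_le_trans _ (ler_norm _)) //; lra.
- apply/seteqP; split => y; last by case=> [[]|[]].
  move=> yZ; have Qy : Q < Psi (dot r y) by rewrite -[Psi _]yZ.
  have [lt|lt|e] := ltgtP (dot r y) z0; [by left|by right|].
  by move: Qy; rewrite e ltNge z0Q.
Qed.

(** As [Psi] never falls below the minimum at [x0], each value of [r] admits exactly one root on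
    either side of [x0]. The left branch becomes a right branch after replacing [s] by [- s]. On
    both graphs [r] takes every real value, so both are unbounded. *)
Lemma valley_pieces s r v w P Q a b (Psi : R -> R) (x0 : R) :
  dot s v = 1 -> dot r v = 0 -> dot s w = 0 -> dot r w = 1 ->
  0 < P -> 0 < Q -> b < 0 -> 0 < a -> continuous Psi ->
  (forall x y, x0 <= x -> x < y -> bi P Q a b x < bi P Q a b y) ->
  (forall x y, y <= x0 -> x < y -> bi P Q a b y < bi P Q a b x) ->
  (forall z, bi P Q a b x0 <= Psi z) ->
  two_pieces [set y | bi P Q a b (dot s y) = Psi (dot r y)].
Proof.
move=> sv rv sw rw P0 Q0 b0 a0 cPsi inc dec minPsi.
have R_unb (M : R) : exists2 z : R, setT z & M < `|z|.
  by exists (M + 1) => //; rewrite (lt_le_trans _ (ler_norm _)) // ltrDl.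
have piece (Phi : R -> R) s' v' x1 : dot s' v' = 1 -> dot r v' = 0 -> dot s' w = 0 ->
    (forall x y, x1 <= x -> x < y -> Phi x < Phi y) ->
    (forall z, exists2 x, x1 <= x & Phi x = Psi z) ->
    let Z := [set y | [/\ Phi (dot s' y) = Psi (dot r y), setT (dot r y) & x1 <= dot s' y]] in
    connected Z /\ (Z = set0 \/ unbounded Z).
  move=> s'v rv' s'w inc' root Z; split.
    apply: (branch_connected (J := fun x => x1 <= x) s'v rv') => //.
    by move=> x y x1x xy; rewrite (le_trans x1x) // ltW.
  right; apply: (@unbounded_of_values Z setT r) => // z Iz.
  exact: (bi_bi_values (J := fun x => x1 <= x) s'v rv' s'w rw Iz).
have negE y : bi P Q a b (dot s y) = bi P Q (- a) (- b) (dot (- s) y).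
  by rewrite dotNl biN !opprK.
exists [set y | [/\ bi P Q a b (dot s y) = Psi (dot r y), setT (dot r y) & x0 <= dot s y]],
  [set y | [/\ bi P Q (- a) (- b) (dot (- s) y) = Psi (dot r y),
    setT (dot r y) & - x0 <= dot (- s) y]].
split.
- by apply: (piece _ s v) => // z; apply: bi_reaches.
- apply: (piece _ (- s) (- v)).
  + by rewrite dotNl dotNr opprK.
  + by rewrite dotNr rv oppr0.
  + by rewrite dotNl sw oppr0.
  + by move=> x y x0x xy; rewrite -!biN; apply: dec; rewrite ?ltrN2 // lerNl.
  + move=> z; have := minPsi z; rewrite -[x0 in bi _ _ _ _ x0]opprK biN biC.
    have b0' : 0 < - b by rewrite oppr_gt0.
    by move=> /(bi_reaches Q0 P0 b0')[x]; rewrite biC; exists x.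
- apply/seteqP; split => y /=.
    move=> yZ; have [h|h] := leP x0 (dot s y); [by left|right].
    by split => //; rewrite -?negE // dotNl lerN2 ltW.
  by case=> -[h _ _] //; rewrite negE.
Qed.

(** Exponents of one weak sign give a monotone side, after the reflection [s] to [- s] if both are
    nonpositive; this is [dich]. The equation is symmetric in its two sides, so a monotone right
    side is handled by exchanging [s] and [r]. If both sides are valleys, the one with the lower
    minimum is solved for. *)
Lemma bi_solutions s r v w P Q a b P' Q' c d :
  dot s v = 1 -> dot r v = 0 -> dot s w = 0 -> dot r w = 1 ->
  0 < P -> 0 < Q -> 0 < P' -> 0 < Q' -> a != b -> c != d ->
  connected (solutions s r P Q a b P' Q' c d) \/
  two_pieces (solutions s r P Q a b P' Q' c d).
Proof.
have dich s' r' v' w' P1 Q1 a1 b1 P1' Q1' c1 d1 :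
    dot s' v' = 1 -> dot r' v' = 0 -> dot s' w' = 0 -> dot r' w' = 1 ->
    0 < P1 -> 0 < Q1 -> 0 < P1' -> 0 < Q1' -> b1 < a1 ->
    (connected (solutions s' r' P1 Q1 a1 b1 P1' Q1' c1 d1) \/
     two_pieces (solutions s' r' P1 Q1 a1 b1 P1' Q1' c1 d1)) \/ (b1 < 0 /\ 0 < a1).
  move=> sv rv sw rw P0 Q0 P'0 Q'0 ba.
  have [b0|b0] := leP 0 b1; first by left; apply: (monotone_pieces _ _ sv rv sw rw).
  have [a0|a0] := ltP 0 a1; [by right|left].
  have -> : solutions s' r' P1 Q1 a1 b1 P1' Q1' c1 d1 =
      solutions (- s') r' Q1 P1 (- b1) (- a1) P1' Q1' c1 d1.
    by apply/seteqP; split => y; rewrite /solutions /= biC dotNl biN !opprK.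
  apply: (@monotone_pieces _ _ (- v') w') => //.
  - by rewrite dotNl dotNr opprK.
  - by rewrite dotNr rv oppr0.
  - by rewrite dotNl sw oppr0.
  - by rewrite oppr_ge0.
  - by rewrite ltrN2.
move=> sv rv sw rw P0 Q0 P'0 Q'0 ab cd.
wlog ba : P Q a b P0 Q0 ab / b < a.
  move=> H; have [h|h|/eqP] := ltgtP b a; [exact: H| |by rewrite eq_sym (negbTE ab)].
  have := H Q P b a Q0 P0; rewrite eq_sym => /(_ ab h).
  by rewrite (_ : solutions _ _ _ _ _ _ _ _ _ _ = solutions s r P Q a b P' Q' c d) //;
    apply/seteqP; split => y; rewrite /solutions /= biC.
wlog dc : P' Q' c d P'0 Q'0 cd / d < c.
  move=> H; have [h|h|/eqP] := ltgtP d c; [exact: H| |by rewrite eq_sym (negbTE cd)].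
  have := H Q' P' d c Q'0 P'0; rewrite eq_sym => /(_ cd h).
  by rewrite (_ : solutions _ _ _ _ _ _ _ _ _ _ = solutions s r P Q a b P' Q' c d) //;
    apply/seteqP; split => y; rewrite /solutions /= => -> ; rewrite biC.
have swapE : solutions r s P' Q' c d P Q a b = solutions s r P Q a b P' Q' c d.
  by apply/seteqP; split => y /=.
have [//|[b0 a0]] := dich _ _ _ _ _ _ _ _ P' Q' c d sv rv sw rw P0 Q0 P'0 Q'0 ba.
have [|[d0 c0]] := dich _ _ _ _ _ _ _ _ P Q a b rw sw rv sv P'0 Q'0 P0 Q0 dc.
  by rewrite swapE.
have [x0 [inc dec]] := bi_valley P0 Q0 a0 b0.
have [z0 [inc' dec']] := bi_valley P'0 Q'0 c0 d0.
have minv (f : R -> R) x1 : (forall x y, x1 <= x -> x < y -> f x < f y) ->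
    (forall x y, y <= x1 -> x < y -> f y < f x) -> forall x, f x1 <= f x.
  by move=> i d' x; have [h|h|->] := ltgtP x x1; [apply/ltW/d'|apply/ltW/i|].
right; have [h|h] := leP (bi P Q a b x0) (bi P' Q' c d z0).
  apply: (valley_pieces sv rv sw rw P0 Q0 b0 a0 (@bi_continuous _ P' Q' c d) inc dec) => z.
  exact: le_trans h (minv _ _ inc' dec' z).
rewrite -swapE.
apply: (valley_pieces rw sw rv sv P'0 Q'0 d0 c0 (@bi_continuous _ P Q a b) inc' dec') => z.
exact: le_trans (ltW h) (minv _ _ inc dec z).
Qed.

End two_by_two.

Section two_two.
Variables (R : realType) (n : nat).
Implicit Types (s r t v w : 'rV[R]_n).

(** The witness is the component [u] of [s] orthogonal to [r], rescaled; its product with [s] is its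
    own square. *)
Lemma separating_vector s r : r != 0 -> ~ parallel s r ->
  exists v, dot s v = 1 /\ dot r v = 0.
Proof.
move=> r0 sr; have rr := dot_gt0 r0.
pose u := s - (dot s r / dot r r) *: r.
have u0 : u != 0.
  apply: contra_notN sr => /eqP /subr0_eq sE.
  by exists (dot s r / dot r r).
have ru : dot r u = 0 by rewrite dotBr dotZr divfK ?gt_eqF // dotC subrr.
have su : dot s u = dot u u by rewrite {2}/u dotBl dotZl ru mulr0 subr0.
exists ((dot u u)^-1 *: u).
by rewrite !dotZr su ru mulr0 mulVf // gt_eqF // dot_gt0.
Qed.

Variables (c1 c2 c3 c4 : R) (l1 l2 l3 l4 : 'rV[R]_n).
Hypotheses (c1_gt0 : 0 < c1) (c2_gt0 : 0 < c2) (c3_gt0 : 0 < c3) (c4_gt0 : 0 < c4).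

Let Z := [set y | c1 * expR (dot l1 y) + c2 * expR (dot l2 y) =
                  c3 * expR (dot l3 y) + c4 * expR (dot l4 y)].

Let s := l1 - l2.
Let r := l3 - l4.
Let t := l2 - l4.

(** The equation is divided by exp(l4 . y), which turns the last term into a constant. *)
Let ZE y : Z y <-> c1 * expR (dot (s + t) y) + c2 * expR (dot t y) =
                   c3 * expR (dot r y) + c4.
Proof.
have e0 := expR_gt0 (dot l4 y).
have e1 : expR (dot l1 y) = expR (dot (s + t) y) * expR (dot l4 y).
  by rewrite -expRD -dotDl /s /t addrA subrK subrK.
have e2 : expR (dot l2 y) = expR (dot t y) * expR (dot l4 y).
  by rewrite -expRD -dotDl /t subrK.
have e3 : expR (dot l3 y) = expR (dot r y) * expR (dot l4 y).
  by rewrite -expRD -dotDl /r subrK.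
rewrite /Z /= e1 e2 e3 !mulrA -!mulrDl; split=> [|->//].
by move/(mulIf (lt0r_neq0 e0)).
Qed.

(** After normalizing t . v = 1, moving by x along [v] multiplies the left side [A] by exp(x) and
    fixes the right side [B]. Each line in direction [v] therefore meets [Z] exactly once, at x =
    ln(B / A). *)
Lemma graph_connected v : dot s v = 0 -> dot r v = 0 -> dot t v != 0 -> connected Z.
Proof.
move=> sv rv; wlog tv : v sv rv / dot t v = 1.
  move=> H tv; apply: (H ((dot t v)^-1 *: v)); rewrite ?dotZr ?sv ?rv ?mulr0 ?mulVf ?oner_eq0 //.
move=> _; pose A y := c1 * expR (dot (s + t) y) + c2 * expR (dot t y).
pose B y := c3 * expR (dot r y) + c4.
have A0 y : 0 < A y by rewrite addr_gt0 // mulr_gt0 ?expR_gt0.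
have B0 y : 0 < B y by rewrite addr_gt0 // mulr_gt0 ?expR_gt0.
have Av y x : A (y + x *: v) = expR x * A y.
  rewrite /A !dotDr !dotZr (dotDl s t v) sv tv add0r mulr1 !expRD; ring.
have Bv y x : B (y + x *: v) = B y by rewrite /B dotDr dotZr rv mulr0 addr0.
pose rt y := ln (B y / A y).
have rtE y : expR (rt y) * A y = B y.
  by rewrite /rt lnK ?posrE ?divr_gt0 // divfK // gt_eqF.
have -> : Z = [set y + rt y *: v | y in setT].
  apply/seteqP; split => [y /ZE yZ|y [x _ <-]]; last by apply/ZE; rewrite -/(A _) -/(B _) Av Bv.
  exists y => //; rewrite /rt; have -> : A y = B y by [].
  by rewrite divff ?gt_eqF // ln1 scale0r addr0.
have cA : continuous A.
  apply: continuous_addr; apply: continuous_mulc; apply: continuous_expR_comp;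
  exact: dot_continuous.
have cB : continuous B.
  apply: continuous_addr; last exact: cst_continuous.
  by apply: continuous_mulc; apply: continuous_expR_comp; exact: dot_continuous.
apply: (@connected_roots R n _ setT (fun y x => expR x * A y - B y) rt id (fun=> v)).
- by apply: seg_convex_connected => ? ?.
- by move=> ?; exact: cvg_id.
- exact: cst_continuous.
- by move=> x; apply: continuous_subr => //; apply: continuous_mulc.
- by move=> y x _ xr; rewrite subr_lt0 -rtE ltr_pM2r // ltr_expR.
- by move=> y x _ xr; rewrite subr_gt0 -rtE ltr_pM2r // ltr_expR.
Qed.

(** The question is whether some direction kills [s] and [r] but not [t]. If so, [Z] is a graph
    along it. If not, [t] lies in the span of [s] and [r]: for parallel [s] and [r] all differences
    are multiples of [r], and for independent ones the equation separates into a function of s . y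
    and one of r . y. *)
Lemma two_two_pieces : l1 != l2 -> l3 != l4 ->
  [\/ connected Z, two_pieces Z | parallel s r /\ parallel t r].
Proof.
rewrite -subr_eq0 -/s => s0; rewrite -subr_eq0 -/r => r0.
have [sr|nsr] := pselect (parallel s r).
  have rr := dot_gt0 r0.
  pose q := t - (dot t r / dot r r) *: r.
  have [q0|q0] := eqVneq q 0.
    by constructor 3; split => //; exists (dot t r / dot r r); exact/subr0_eq.
  have rq : dot r q = 0 by rewrite dotBr dotZr divfK ?gt_eqF // dotC subrr.
  constructor 1; apply: (graph_connected (v := q)) => //.
    by case: sr => k ->; rewrite dotZl rq mulr0.
  have -> : dot t q = dot q q by rewrite {2}/q (dotBl t) dotZl rq mulr0 subr0.
  by rewrite gt_eqF // dot_gt0.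
have [v [sv rv]] := separating_vector r0 nsr.
have [w [rw sw]] := separating_vector s0 (fun rs => nsr (parallel_sym r0 rs)).
pose q := t - dot t v *: s - dot t w *: r.
have [q0|q0] := eqVneq q 0; last first.
  (* Subtracting multiples of the dual vectors [v] and [w] makes [q] orthogonal to [s] and [r]; the
     product with [t] becomes the square of [q], hence nonzero. *)
  constructor 1; apply: (graph_connected (v := q - dot s q *: v - dot r q *: w)).
  - by rewrite !dotBr !dotZr sv sw mulr1 mulr0 subrr subr0.
  - by rewrite !dotBr !dotZr rv rw mulr1 mulr0 subr0 subrr.
  - have := dot_gt0 q0.
    have -> : dot q q = dot t q - dot t v * dot s q - dot t w * dot r q.
      by rewrite {1}/q (dotBl (t - _)) (dotBl t) !dotZl.
    by rewrite (mulrC (dot t v)) (mulrC (dot t w)) -!dotZr -!dotBr => /lt0r_neq0.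
have tE : t = dot t v *: s + dot t w *: r.
  by apply/eqP; rewrite -subr_eq0 opprD addrA -/q q0.
set al := dot t v in tE; set be := dot t w in tE.
(* With t = al s + be r, dividing both sides by exp(be (r . y)) separates the variables. *)
have -> : Z = [set y | bi c1 c2 (1 + al) al (dot s y) = bi c3 c4 (1 - be) (- be) (dot r y)].
  have bE y : expR (be * dot r y) * bi c1 c2 (1 + al) al (dot s y) =
      c1 * expR (dot (s + t) y) + c2 * expR (dot t y).
    have ty : dot t y = al * dot s y + be * dot r y by rewrite tE dotDl !dotZl.
    rewrite (dotDl s t) ty /bi mulrDl mul1r !expRD; ring.
  have bE' y : expR (be * dot r y) * bi c3 c4 (1 - be) (- be) (dot r y) =
      c3 * expR (dot r y) + c4.
    rewrite /bi mulrDr !(mulrCA (expR _)) -!expRD.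
    by congr (_ * expR _ + _); rewrite ?mulNr ?subrr ?expR0 ?mulr1 //; ring.
  apply/seteqP; split => y => [/ZE|/= h].
    by rewrite -bE -bE' => /(mulfI (lt0r_neq0 (expR_gt0 _))).
  by apply/ZE; rewrite -bE -bE' h.
have ab : 1 + al != al by rewrite -subr_eq0 addrK oner_eq0.
have cd : 1 - be != - be by rewrite -subr_eq0 opprK subrK oner_eq0.
have [h|h] := bi_solutions sv rv sw rw c1_gt0 c2_gt0 c3_gt0 c4_gt0 ab cd.
- by constructor 1.
- by constructor 2.
Qed.

End two_two.

(** * Univariate exponential sums *)

Section exponential_sums.
Variable R : realType.
Implicit Types (c k z : nat -> R).

Let expsum m c k (x : R) := \sum_(j < m) c j * expR (k j * x).

Let expsum_derive m c k (x : R) :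
  is_derive x 1 (expsum m c k) (expsum m (fun j => c j * k j) k x).
Proof.
have -> : expsum m c k = \sum_(j < m) (fun x => c j * expR (k j * x)).
  by apply/funext => y; rewrite fct_sumE.
apply: is_derive_sum => j.
have h : is_derive x 1 ( *%R (k j)) (k j).
  by rewrite -[X in is_derive _ _ _ X]mulr1; exact: (is_deriveZ (k j) (is_derive_id x 1)).
have he : is_derive x 1 (expR \o *%R (k j)) (expR (k j * x) * k j).
  exact: is_derive1_comp.
by rewrite -mulrA (mulrC (k j)); exact: (is_deriveZ (c j) he).
Qed.

(** Induction by Rolle's theorem: multiplying by an exponential makes the last exponent 0 without
    moving the zeros, and differentiating then removes the last term. One term and one zero are lost
    together, down to a single nonvanishing exponential. *)
Lemma expsum_zeros m c k z :
  (forall i, (i <= m)%N -> c i != 0) ->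
  (forall i j, (i <= m)%N -> (j <= m)%N -> k i = k j -> i = j) ->
  (forall i, (i < m)%N -> z i < z i.+1) ->
  ~ (forall i, (i <= m)%N -> expsum m.+1 c k (z i) = 0).
Proof.
elim: m => [|m IH] in c k z * => c0 kinj zmono zeros.
  have := zeros 0%N (leqnn _); rewrite /expsum big_ord1 => /eqP.
  by rewrite mulf_eq0 (negbTE (c0 _ _)) // gt_eqF // expR_gt0.
pose k' j := k j - k m.+1; pose c' j := c j * k' j.
have shift x : expsum m.+2 c k' x = expR (- k m.+1 * x) * expsum m.+2 c k x.
  rewrite /expsum mulr_sumr; apply: eq_bigr => j _.
  by rewrite mulrCA -expRD; congr (_ * expR _); rewrite /k'; ring.
have zeros' i : (i <= m.+1)%N -> expsum m.+2 c k' (z i) = 0.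
  by move=> im; rewrite shift zeros // mulr0.
have rolle i : (i <= m)%N -> exists w, z i < w < z i.+1 /\ expsum m.+1 c' k' w = 0.
  move=> im; have [|||w wz wd] := @Rolle R (expsum m.+2 c k') (z i) (z i.+1) (zmono _ im).
  - by move=> x _; have [] := expsum_derive m.+2 c k' x.
  - apply: continuous_subspaceT => x; apply: differentiable_continuous.
    by apply/derivable1_diffP; have [] := expsum_derive m.+2 c k' x.
  - by rewrite !zeros' // ltnW.
  exists w; split; first by move: wz; rewrite in_itv.
  have [_ e] := expsum_derive m.+2 c k' w; have [_ e'] := wd.
  rewrite e in e'; rewrite -[RHS]e' /expsum [RHS]big_ord_recr /=.
  have -> : k' m.+1 = 0 by rewrite /k' subrr.
  by rewrite mulr0 mul0r addr0.
pose w i := xget 0 [set x | z i < x < z i.+1 /\ expsum m.+1 c' k' x = 0].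
have wP i : (i <= m)%N -> z i < w i < z i.+1 /\ expsum m.+1 c' k' (w i) = 0.
  by move=> /rolle [x xP]; rewrite /w; case: xgetP => [_ -> //|/(_ x)].
apply: (IH c' k' w).
- move=> i im; rewrite mulf_neq0 ?c0 ?(leqW im) // subr_eq0.
  apply/eqP => /kinj; rewrite leqnn leqW // => /(_ isT isT) e.
  by rewrite e ltnn in im.
- by move=> i j im jm /addIr /kinj; apply; exact: leqW.
- move=> i im; have [/andP[_ h1] _] := wP _ (ltnW im).
  by have [/andP[h2 _] _] := wP _ im; exact: lt_trans h1 h2.
- by move=> i /wP[].
Qed.

(** If no list of [m] values contained all zeros, zeros could be added one at a time to reach [m.+1]
    distinct ones; sorted, they contradict [expsum_zeros]. The values [z i] only have to cover the
    zeros, so a shorter list is padded with 0. *)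
Lemma expsum_roots m c k :
  (forall i, (i <= m)%N -> c i != 0) ->
  (forall i j, (i <= m)%N -> (j <= m)%N -> k i = k j -> i = j) ->
  exists z : 'I_m -> R, forall x, expsum m.+1 c k x = 0 -> exists i, x = z i.
Proof.
move=> c0 kinj; apply: contrapT => nroots.
have more (s : seq R) : (size s <= m)%N -> exists x, expsum m.+1 c k x = 0 /\ x \notin s.
  move=> sm; apply: contrapT => nx; apply: nroots.
  exists (fun i => nth 0 s i) => x x0.
  have xs : x \in s by apply/negPn/negP => xs; apply: nx; exists x.
  have im : (index x s < m)%N by rewrite (leq_trans _ sm) // index_mem.
  by exists (Ordinal im); rewrite /= nth_index.
have [s [us ss zs]] : exists s : seq R, [/\ uniq s, size s = m.+1 &
    forall x, x \in s -> expsum m.+1 c k x = 0].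
  suff H j : (j <= m.+1)%N -> exists s : seq R, [/\ uniq s, size s = j &
      forall x, x \in s -> expsum m.+1 c k x = 0] by exact: H.
  elim: j => [|j IH] jm; first by exists [::].
  have [s [us ss zs]] := IH (ltnW jm).
  have [|x [x0 xs]] := more s; first by rewrite ss.
  exists (x :: s); split => [|/=|y]; rewrite /= ?xs ?ss //.
  by rewrite inE => /predU1P[->//|/zs].
pose q := sort <=%O s.
have sq : size q = m.+1 by rewrite size_sort.
have stq : sorted <%O q by rewrite sort_lt_sorted.
apply: (@expsum_zeros m c k (nth 0 q) c0 kinj).
  by move=> i im; apply: (sortedP 0 stq); rewrite sq.
by move=> i im; apply: zs; rewrite -(mem_sort <=%O) mem_nth // sq.
Qed.

End exponential_sums.

(** * Zero sets in logarithmic coordinates *)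

Definition log_zeros (R : realType) n m (c : 'I_m -> R) (a : 'I_m -> 'rV[R]_n) :=
  [set y : 'rV[R]_n | \sum_(i < m) c i * expR (dot (a i) y) = 0].

Definition collinear (R : realType) n m (a : 'I_m -> 'rV[R]_n) :=
  exists (p b : 'rV[R]_n) (k : 'I_m -> R), forall i, a i = p + k i *: b.

Section log_zeros.
Variables (R : realType) (n m : nat).
Implicit Types (c : 'I_m -> R) (a : 'I_m -> 'rV[R]_n).

Lemma parallel_collinear a b (i0 : 'I_m) :
  (forall i, parallel (a i - a i0) b) -> collinear a.
Proof.
move=> /choice[k kE]; exists (a i0), b, k => i.
by rewrite -kE addrC subrK.
Qed.

(** Dividing by the exponential of index [i0] gives a level set of a positive exponential sum with
    vectors [a i - a i0]. If the exponents are not collinear, two of these vectors are not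
    parallel. *)
Lemma log_zeros_one_negative c a (i0 : 'I_m) : injective a ->
  c i0 < 0 -> (forall i, i != i0 -> 0 < c i) ->
  collinear a \/ connected (log_zeros c a).
Proof.
move=> inja ci0 cpos.
have [[j0 j0i0]|noj] := pselect (exists j, j != i0); last first.
  left; apply: (@parallel_collinear a 0 i0) => i; exists 0; rewrite scale0r.
  by have [->|ii0] := eqVneq i i0; [rewrite subrr|case: noj; exists i].
have [par|npar] := pselect (forall i, parallel (a i - a i0) (a j0 - a i0)).
  by left; exact: parallel_collinear par.
move/existsNP: npar => [i ni]; right.
have ii0 : i != i0.
  by apply: contra_notN ni => /eqP ->; exists 0; rewrite subrr scale0r.
have -> : log_zeros c a = [set y |
    \sum_(i < m | i != i0) c i * expR (dot (a i - a i0) y) = - c i0].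
  have sumE y : \sum_(i < m) c i * expR (dot (a i) y) = expR (dot (a i0) y) *
      (c i0 + \sum_(i < m | i != i0) c i * expR (dot (a i - a i0) y)).
    rewrite (bigD1 i0) //= mulrDr mulrC mulr_sumr; congr (_ + _).
    by apply: eq_bigr => k _; rewrite mulrCA -expRD dotBl addrC subrK.
  apply/seteqP; split => y; rewrite /log_zeros /= sumE.
    by move=> /eqP; rewrite mulf_eq0 gt_eqF ?expR_gt0 //= addrC addr_eq0 => /eqP.
  by move=> ->; rewrite subrr mulr0.
apply: (@one_negative_connected _ _ _ (fun i => i != i0) _ _ _ cpos i j0) => // k ki0.
by rewrite subr_eq0; apply: contra ki0 => /eqP /inja ->.
Qed.

Lemma log_zeros_two_two c a (i1 i2 i3 i4 : 'I_m) : injective a ->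
  uniq [:: i1; i2; i3; i4] -> (forall i, i \in [:: i1; i2; i3; i4]) ->
  0 < c i1 -> 0 < c i2 -> c i3 < 0 -> c i4 < 0 ->
  [\/ collinear a, connected (log_zeros c a) | two_pieces (log_zeros c a)].
Proof.
move=> inja u4 all4 c1 c2 c3 c4.
have -> : log_zeros c a = [set y |
    c i1 * expR (dot (a i1) y) + c i2 * expR (dot (a i2) y) =
    - c i3 * expR (dot (a i3) y) + - c i4 * expR (dot (a i4) y)].
  have sumE y : \sum_(i < m) c i * expR (dot (a i) y) =
     c i1 * expR (dot (a i1) y) + c i2 * expR (dot (a i2) y) -
    (- c i3 * expR (dot (a i3) y) + - c i4 * expR (dot (a i4) y)).
    rewrite (perm_big [:: i1; i2; i3; i4]) /=; last first.
      apply: uniq_perm => //; first exact: index_enum_uniq.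
      by move=> i; rewrite all4 mem_index_enum.
    by rewrite !big_cons big_nil; ring.
  apply/seteqP; split => y; rewrite /log_zeros /= sumE; first by move/subr0_eq.
  by move=> ->; rewrite subrr.
have [n12 n34] : i1 != i2 /\ i3 != i4.
  by move: u4; rewrite /= !inE; case: (i1 =P i2) => //=;
    case: (i3 =P i4) => //=; rewrite ?andbF ?orbF.
have n12' : a i1 != a i2 by apply: contra n12 => /eqP /inja ->.
have n34' : a i3 != a i4 by apply: contra n34 => /eqP /inja ->.
have p3 : 0 < - c i3 by rewrite oppr_gt0.
have p4 : 0 < - c i4 by rewrite oppr_gt0.
have [h|h|[[k ks] [l lt]]] := two_two_pieces c1 c2 p3 p4 n12' n34'.
- by constructor 2.
- by constructor 3.
(* Here a1 - a2 = k r and a2 - a4 = l r with r = a3 - a4, so a1 - a4 = (k + l) r. *)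
constructor 1; apply: (@parallel_collinear a (a i3 - a i4) i4) => i.
have := all4 i; rewrite !inE => /or4P[] /eqP ->.
- exists (k + l); rewrite scalerDl -ks -lt; by rewrite addrA subrK.
- by exists l.
- by exists 1; rewrite scale1r.
- by exists 0; rewrite scale0r subrr.
Qed.

(** Changing all signs preserves the zeros, so the negative coefficients may be assumed no more
    numerous than the positive ones. There are then at most two of them: two forces signs (+,+,-,-),
    one is the convex case, and with none there are no zeros. *)
Lemma log_zeros_trichotomy c a : (m <= 4)%N -> (forall i, c i != 0) -> injective a ->
  [\/ collinear a, connected (log_zeros c a) | two_pieces (log_zeros c a)].
Proof.
move=> m4 c0 inja.
wlog le_np : c c0 / (#|finset (fun i => c i < 0)%R| <= #|finset (fun i => 0 < c i)%R|)%N.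
  move=> H; have [h|h] := leqP #|finset (fun i => c i < 0)%R| #|finset (fun i => 0 < c i)%R|.
    exact: H.
  have -> : log_zeros c a = log_zeros (fun i => - c i) a.
    have NE y : \sum_(i < m) - c i * expR (dot (a i) y) =
        - \sum_(i < m) c i * expR (dot (a i) y).
      by rewrite -sumrN; apply: eq_bigr => i _; rewrite mulNr.
    apply/seteqP; split => y; rewrite /log_zeros /= NE.
      by move=> ->; rewrite oppr0.
    by move=> /eqP; rewrite oppr_eq0 => /eqP.
  apply: H => [i|]; first by rewrite oppr_eq0.
  have -> : finset (fun i => - c i < 0) = finset (fun i => 0 < c i)
    by apply/setP => i; rewrite !inE oppr_lt0.
  have -> : finset (fun i => 0 < - c i) = finset (fun i => c i < 0)
    by apply/setP => i; rewrite !inE oppr_gt0.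
  exact: ltnW.
set N := finset _ in le_np; set P := finset _ in le_np.
have PN : P = (~: N)%SET.
  by apply/setP => i; rewrite !inE; case: ltgtP (c0 i) => // ->; rewrite eqxx.
have cardPN : (#|N| + #|P| = m)%N by rewrite PN cardsC card_ord.
have cpos i : i \notin N -> 0 < c i by rewrite -finset.in_setC -PN inE.
have cneg i : i \in N -> c i < 0 by rewrite inE.
have : (#|N| <= 2)%N by lia.
rewrite leq_eqVlt => /predU1P[N2|]; last rewrite ltnS leq_eqVlt => /predU1P[N1|].
- have P2 : #|P| = 2 by lia.
  move/eqP/cards2P: N2 => [i3 [i4 [n34 NE]]]; move/eqP/cards2P: P2 => [i1 [i2 [n12 PE]]].
  have i1N : i1 \notin N by rewrite -finset.in_setC -PN PE !inE eqxx.
  have i2N : i2 \notin N by rewrite -finset.in_setC -PN PE !inE eqxx orbT.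
  have i3N : i3 \in N by rewrite NE !inE eqxx.
  have i4N : i4 \in N by rewrite NE !inE eqxx orbT.
  apply: (@log_zeros_two_two c a i1 i2 i3 i4) => //; rewrite ?cpos ?cneg //.
    rewrite /= !inE (negbTE n12) (negbTE n34) /= !andbT.
    by move: i1N i2N; rewrite NE !inE => -> ->.
  move=> i; have [iN|] := boolP (i \in N).
    by move: iN; rewrite NE !inE => /orP[] ->; rewrite !orbT.
  by rewrite -finset.in_setC -PN PE !inE => /orP[] ->; rewrite ?orbT.
- move/eqP/cards1P: N1 => [i0 NE].
  have [||h|h] := @log_zeros_one_negative c a i0 inja.
  + by apply: cneg; rewrite NE inE.
  + by move=> i ii0; apply: cpos; rewrite NE inE.
  + by constructor 1.
  + by constructor 2.
rewrite ltnS leqn0 cards_eq0 => /eqP N0.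
(* The empty sum vanishes everywhere; it is classified as collinear. *)
have [[i _]|noi] := pselect (exists i : 'I_m, True); last first.
  by constructor 1; exists 0, 0, (fun=> 0) => i; case: noi; exists i.
constructor 2; rewrite (_ : log_zeros c a = set0); first exact: connected0.
apply/seteqP; split => // y /= /eqP.
rewrite psumr_eq0 => [/allP/(_ i (mem_index_enum _))|j _].
  by rewrite /= mulf_eq0 (negbTE (c0 i)) gt_eqF // expR_gt0.
by rewrite mulr_ge0 ?expR_ge0 // ltW // cpos // N0 inE.
Qed.

End log_zeros.

(** * Counting components *)

Lemma counting_le_image (R : realType) (T : choiceType) N (F : 'I_N -> T) (A : set T) :
  A `<=` range F -> (counting A <= N%:R%:E :> \bar R)%E.
Proof.
move=> AF; have finF : finite_set (range F) by exact: finite_image.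
have finA : finite_set A by exact: sub_finite_set finF.
rewrite /counting asboolT // lee_fin ler_nat.
rewrite -[leqRHS](card_ord N) cardE -(size_map F).
apply: uniq_leq_size; first exact: finmap.fset_uniq.
move=> x; rewrite in_fset_set // inE => /AF [i _ <-].
by apply/mapP; exists i => //; rewrite mem_enum.
Qed.

Lemma counting_ge (R : realType) (T : choiceType) N (F : 'I_N -> T) (A : set T) :
  injective F -> (forall i, A (F i)) -> (N%:R%:E <= counting A :> \bar R)%E.
Proof.
move=> injF FA; rewrite /counting; case: asboolP => [finA|_]; last exact: leey.
rewrite lee_fin ler_nat -[leqLHS](card_ord N) cardE -(size_map F).
apply: uniq_leq_size; first by rewrite map_inj_uniq // enum_uniq.
by move=> x /mapP[i _ ->]; rewrite in_fset_set // inE; exact: FA.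
Qed.

Section components.
Variables (R : realType) (n : nat).
Implicit Types (X Z C : set 'rV[R]_n).

(** Each connected [C i] lies in one component, so the components of one chosen point from each
    [C i] are all of them. An empty [C i] yields the default point 0, which only enlarges the
    list. *)
Lemma Tot_le_cover N (C : 'I_N -> set 'rV[R]_n) X :
  (forall i, connected (C i)) -> X = \bigcup_i C i -> (Tot X <= N%:R%:E)%E.
Proof.
move=> cC XE.
apply: (@counting_le_image _ _ _ (fun i => connected_component X (xget 0 (C i)))).
move=> _ [x Xx <-]; have : X x by [].
rewrite {1}XE => -[i _ Cix]; exists i => //.
apply/same_connected_component; exists (C i) => //; split => //.
  by case: xgetP => [y _ //|/(_ _ Cix)].
by rewrite XE; exact: bigcup_sup.
Qed.

Lemma counting_subset (T : choiceType) (A B : set T) :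
  A `<=` B -> (counting A <= counting B :> \bar R)%E.
Proof.
move=> AB; rewrite /counting; case: (asboolP (finite_set B)) => [fB|_]; last exact: leey.
have fA := sub_finite_set AB fB; rewrite asboolT // lee_fin ler_nat.
apply: uniq_leq_size; first exact: finmap.fset_uniq.
by move=> x; rewrite !in_fset_set // !inE; exact: AB.
Qed.

Lemma Comp_le_Tot X : (Comp X <= Tot X)%E.
Proof. by apply: counting_subset => C []. Qed.

Lemma Non_le_Tot X : (Non X <= Tot X)%E.
Proof. by apply: counting_subset => C []. Qed.

Definition Exp (y : 'rV[R]_n) : 'rV[R]_n := \row_j expR (y ord0 j).
Definition Log (x : 'rV[R]_n) : 'rV[R]_n := \row_j ln (x ord0 j).

Lemma ExpK y : Log (Exp y) = y.
Proof. by apply/rowP => j; rewrite !mxE expRK. Qed.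

Lemma LogK x : orthant x -> Exp (Log x) = x.
Proof. by move=> x0; apply/rowP => j; rewrite !mxE lnK // posrE; exact: x0. Qed.

Lemma Exp_orthant y : orthant (Exp y).
Proof. by move=> j; rewrite mxE expR_gt0. Qed.

Lemma Exp_continuous : continuous Exp.
Proof.
apply: continuous_rV => j; under eq_fun do rewrite mxE.
by apply: continuous_expR_comp; exact: coord_continuous.
Qed.

Lemma Exp_connected C : connected C -> connected (Exp @` C).
Proof.
move=> cC; apply: connected_continuous_connected => //.
by apply: continuous_subspaceT; exact: Exp_continuous.
Qed.

Lemma monomial_Exp (a y : 'rV[R]_n) : monomial a (Exp y) = expR (dot a y).
Proof.
rewrite /monomial /dot expR_sum; apply: eq_bigr => j _.
by rewrite mxE /powR gt_eqF ?expR_gt0 // expRK.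
Qed.

Lemma zero_set_Exp m (c : 'I_m -> R) (a : 'I_m -> 'rV[R]_n) f :
  nomial_repr c a f -> zero_set f = Exp @` log_zeros c a.
Proof.
move=> [_ _ fE]; apply/seteqP; split => [x [x0 fx]|_ [y yZ <-]].
  exists (Log x); last exact: LogK.
  rewrite /log_zeros /= -[RHS]fx fE //; apply: eq_bigr => i _.
  by rewrite -monomial_Exp LogK.
split; first exact: Exp_orthant.
rewrite fE; last exact: Exp_orthant.
by rewrite -[RHS]yZ; apply: eq_bigr => i _; rewrite monomial_Exp.
Qed.

(** The linear form composed with [Log] is continuous on the orthant, so it would be bounded on a
    compact [C]. *)
Lemma unbounded_not_compact Z C : C `<=` @orthant R n -> unbounded Z ->
  Exp @` Z `<=` C -> ~ compact C.
Proof.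
move=> Co [l lZ] ZC kC.
have cl : {within C, continuous (fun x => dot l (Log x))}.
  apply: continuous_in_subspaceT => x; rewrite inE => /Co x0.
  apply: (continuous_comp (f := Log) (g := dot l)); last exact: dot_continuous.
  apply: continuous_rV_at => j; under eq_fun do rewrite mxE.
  apply: (continuous_comp (f := fun x : 'rV[R]_n => x ord0 j) (g := @ln R)).
    exact: coord_continuous.
  exact: continuous_ln.
have [M [_ MB]] := compact_bounded (continuous_compact cl kC).
have [y Zy My] := lZ (`|M| + 1).
have : `|dot l y| <= `|M| + 1.
  apply: (MB (`|M| + 1)); first by rewrite (le_lt_trans (ler_norm M)) // ltrDl.
  by exists (Exp y); [apply: ZC; exists y|rewrite ExpK].
by rewrite leNgt My.
Qed.

(** A component contains the image of the unbounded connected set through any of its points. *)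
Lemma Comp_Exp_unbounded Z :
  (forall y, Z y -> exists C, [/\ C y, C `<=` Z, connected C & unbounded C]) ->
  Comp (Exp @` Z) = 0%E.
Proof.
move=> Zunb; rewrite /Comp (_ : _ `&` _ = set0).
  by rewrite /counting asboolT ?fset_set0 //; exact: finite_set0.
apply/seteqP; split => // _ [[x [y Zy <-] <-] /= kC].
have [C [Cy CZ cC uC]] := Zunb _ Zy.
apply: unbounded_not_compact uC _ kC.
  by move=> z /connected_component_sub [z' _ <-]; exact: Exp_orthant.
apply: connected_component_max; [by exists y|exact: image_subset|exact: Exp_connected].
Qed.

(** Factoring out exp(p . y) leaves a univariate exponential sum in b . y, whose exponents [k i] are
    distinct because the [a i] are. *)
Lemma collinear_log_zeros m (c : 'I_m.+1 -> R) (a : 'I_m.+1 -> 'rV[R]_n)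
    (p b : 'rV[R]_n) (k : 'I_m.+1 -> R) :
  (forall i, c i != 0) -> injective a -> (forall i, a i = p + k i *: b) ->
  exists z : 'I_m -> R, forall y, log_zeros c a y -> exists i, dot b y = z i.
Proof.
move=> c0 inja aE.
have injk : injective k by move=> i j ij; apply: inja; rewrite !aE ij.
have [||z zP] := @expsum_roots R m (fun i => c (inord i)) (fun i => k (inord i)).
- by [].
- by move=> i j im jm /injk /(congr1 val); rewrite /= !inordK.
exists z => y yZ; apply: zP.
apply: (mulfI (lt0r_neq0 (expR_gt0 (dot p y)))); rewrite mulr0 -[RHS]yZ mulr_sumr.
apply: eq_bigr => i _; rewrite inord_val mulrCA -expRD aE dotDl dotZl.
by [].
Qed.

(** Between points with the same b . y the sum only changes by the factor exp(p . (y' - y)), so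
    [log_zeros] is a union of full slices. *)
Lemma log_zeros_collinear_invariant m (c : 'I_m -> R) (a : 'I_m -> 'rV[R]_n)
    (p b : 'rV[R]_n) (k : 'I_m -> R) (y y' : 'rV[R]_n) :
  (forall i, a i = p + k i *: b) -> dot b y' = dot b y ->
  log_zeros c a y -> log_zeros c a y'.
Proof.
move=> aE yy' yZ.
have := congr1 ( *%R (expR (dot p (y' - y)))) yZ; rewrite mulr0 mulr_sumr => yZ'.
rewrite /log_zeros /= -[RHS]yZ'.
apply: eq_bigr => i _; rewrite mulrCA -expRD aE !dotDl !dotZl yy' dotBr.
by congr (_ * expR _); ring.
Qed.

Lemma collinear_slice_connected m (c : 'I_m -> R) (a : 'I_m -> 'rV[R]_n)
    (p b : 'rV[R]_n) (k : 'I_m -> R) (z : R) :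
  (forall i, a i = p + k i *: b) ->
  connected [set y | log_zeros c a y /\ dot b y = z].
Proof.
move=> aE; apply: seg_convex_connected => x y t [xZ xz] [yZ yz] t0 t1.
have bz : dot b (x + t *: (y - x)) = z.
  by rewrite dotDr dotZr dotBr xz yz subrr mulr0 addr0.
by split => //; apply: (log_zeros_collinear_invariant aE _ xZ); rewrite bz xz.
Qed.

End components.

(** * Upper bounds on the numbers of components *)

Section bounds.
Variable R : realType.

Lemma Tot_collinear n m (c : 'I_m -> R) (a : 'I_m -> 'rV[R]_n) f :
  nomial_repr c a f -> (0 < m)%N -> collinear a -> (Tot (zero_set f) <= m.-1%:R%:E)%E.
Proof.
move=> ff; case: m c a ff => // m c a ff _ [p [b [k aE]]].
have [c0 inja _] := ff; rewrite (zero_set_Exp ff) /=.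
have [z zP] := collinear_log_zeros c0 inja aE.
apply: (@Tot_le_cover _ _ _ (fun i => (@Exp R n) @` [set y | log_zeros c a y /\ dot b y = z i])).
  by move=> i; apply: Exp_connected; exact: collinear_slice_connected aE.
apply/seteqP; split => [_ [y yZ <-]|_ [i _ [y [yZ _] <-]]]; last by exists y.
by have [i yi] := zP _ yZ; exists i => //; exists y.
Qed.

Lemma Tot_connected n (Z : set 'rV[R]_n) : connected Z ->
  (Tot ((@Exp R n) @` Z) <= 1%:E)%E.
Proof.
move=> cZ; apply: (@Tot_le_cover _ _ 1 (fun=> (@Exp R n) @` Z)).
  by move=> _; exact: Exp_connected.
by apply/seteqP; split => [x xZ|x [_ _]]; [exists ord0|].
Qed.

Lemma Tot_two_pieces n (Z : set 'rV[R]_n) : two_pieces Z ->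
  (Tot ((@Exp R n) @` Z) <= 2%:R%:E)%E.
Proof.
move=> [Z1 [Z2 [[c1 _] [c2 _] ->]]].
apply: (@Tot_le_cover _ _ 2 (fun i => (@Exp R n) @` (if i == ord0 then Z1 else Z2))).
  by move=> i; apply: Exp_connected; case: ifP.
rewrite image_setU; apply/seteqP; split => [x [xZ|xZ]|x [i _]].
- by exists ord0.
- by exists ord_max.
- by case: ifP => _; [left|right].
Qed.

Lemma Tot_not_collinear n m (c : 'I_m -> R) (a : 'I_m -> 'rV[R]_n) f :
  (m <= 4)%N -> nomial_repr c a f -> ~ collinear a -> (Tot (zero_set f) <= 2%:R%:E)%E.
Proof.
move=> m4 ff ncol; have [c0 inja _] := ff; rewrite (zero_set_Exp ff).
have [//|h|h] := log_zeros_trichotomy m4 c0 inja; last exact: Tot_two_pieces.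
by apply: le_trans (Tot_connected h) _; rewrite lee_fin ler1n.
Qed.

Lemma Tot_Omega n f : @Omega R n 4 f -> (Tot (zero_set f) <= 3%:R%:E)%E.
Proof.
move=> [m /andP[m0 m4] [c [a ff]]].
have [col|ncol] := pselect (collinear a).
  by apply: le_trans (Tot_collinear ff m0 col) _; rewrite lee_fin ler_nat; lia.
by apply: le_trans (Tot_not_collinear m4 ff ncol) _; rewrite lee_fin ler_nat.
Qed.

(** A nonzero [b] is turned by a right angle. In the plane this gives every slice with b . y
    constant a direction in which it is unbounded. *)
Lemma orthogonal_vector2 (b : 'rV[R]_2) : exists2 v, v != 0 & dot b v = 0.
Proof.
have [->|b0] := eqVneq b 0.
  exists (const_mx 1); last exact: dot0l.
  by apply/eqP => /rowP /(_ ord0); rewrite !mxE => /eqP; rewrite oner_eq0.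
exists (\row_j if j == ord0 then b ord0 ord_max else - b ord0 ord0).
  apply: contra b0 => /eqP /rowP v0; apply/eqP/rowP => j.
  have := v0 ord0; have := v0 ord_max; rewrite !mxE /= => /eqP.
  rewrite oppr_eq0 => /eqP b00 b01.
  case: j => [[|[|//]]] j2; [rewrite -[RHS]b00|rewrite -[RHS]b01]; congr (b _ _); exact: val_inj.
rewrite /dot !big_ord_recl big_ord0 !mxE /= addr0.
rewrite (_ : lift ord0 ord0 = ord_max); last exact: val_inj.
by rewrite mulrN mulrC subrr.
Qed.

(** Compact components can occur only when the zero set is connected, and then there is at most one.
    In the collinear case each zero lies on an unbounded slice, and in the remaining case on an
    unbounded piece. *)
Lemma Comp_Omega f : @Omega R 2 4 f -> (Comp (zero_set f) <= 1%:R%:E)%E.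
Proof.
move=> [m /andP[m0 m4] [c [a ff]]]; have [c0 inja _] := ff; rewrite (zero_set_Exp ff).
suff [unb|cZ] : (forall y, log_zeros c a y ->
    exists C, [/\ C y, C `<=` log_zeros c a, connected C & unbounded C])
    \/ connected (log_zeros c a).
- by rewrite Comp_Exp_unbounded // lee_fin ler0n.
- exact: le_trans (Comp_le_Tot _) (Tot_connected cZ).
have [[p [b [k aE]]]|cZ|[Z1 [Z2 [[c1 u1] [c2 u2] ->]]]] := log_zeros_trichotomy m4 c0 inja.
- left=> y yZ; exists [set y' | log_zeros c a y' /\ dot b y' = dot b y]; split => //.
  + by move=> ? [].
  + exact: collinear_slice_connected aE.
  have [v v0 bv] := orthogonal_vector2 b; have vv := dot_gt0 v0.
  exists v => M; pose t := (M + 1 - dot v y) / dot v v.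
  have ty : dot v (y + t *: v) = M + 1.
    by rewrite dotDr dotZr /t divfK ?gt_eqF // addrC subrK.
  exists (y + t *: v).
    have byt : dot b (y + t *: v) = dot b y by rewrite dotDr dotZr bv mulr0 addr0.
    by split => //; exact: (log_zeros_collinear_invariant aE byt yZ).
  by rewrite ty (lt_le_trans _ (ler_norm _)) // ltrDl.
- by right.
- left=> y [yZ|yZ]; [exists Z1|exists Z2]; split => //.
  + by case: u1 => [Z0|//]; rewrite Z0 in yZ.
  + by case: u2 => [Z0|//]; rewrite Z0 in yZ.
Qed.

End bounds.

(** A line [L] through collinear exponents is convex and closed under affine combinations, so it
    contains the affine span of the Newton polytope. The direction space [U] then lies in the span
    of [b] and has dimension at most 1. *)
Lemma dim2_not_collinear (R : realType) n m (a : 'I_m -> 'rV[R]_n) :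
  has_dim (Newt a) 2 -> ~ collinear a.
Proof.
move=> [q [U [spanE dimU]]] [p [b [k aE]]].
pose L := [set y : 'rV[R]_n | exists x : R, y = p + x *: b].
have NL : Newt a `<=` L.
  apply: smallest_sub => [x y t|_ [i _ <-]]; last by exists (k i).
  rewrite !inE => -[u ->] [v ->].
  exists (t%:num * u + (1 - t%:num) * v).
  (* The abstract convex combination unfolds to this vector expression. *)
  change (t%:num *: (p + u *: b) + (1 - t%:num) *: (p + v *: b) =
    p + (t%:num * u + (1 - t%:num) * v) *: b).
  rewrite !scalerDr addrACA -scalerDl (addrCA t%:num) subrr addr0 scale1r.
  by rewrite !scalerA -scalerDl.
have spanL : affine_span (Newt a) `<=` L.
  move=> _ [l [t [v [vN t1 ->]]]].
  have /choice[x xE] : forall i, exists x, v i = p + x *: b by move=> i; exact: NL.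
  exists (\sum_i t i * x i); rewrite scaler_suml -[in p + _](scale1r p) -t1 scaler_suml -big_split.
  by apply: eq_bigr => i _; rewrite xE scalerDr scalerA.
rewrite spanE in spanL.
have [x0 qE] : L q by apply: spanL; exists 0; rewrite /= ?mem0v // addr0.
have : (U <= <[b]>)%VS.
  apply/subvP => u uU; have [x quE] : L (q + u) by apply: spanL; exists u.
  apply/vlineP; exists (x - x0); rewrite scalerBl.
  apply: (addrI q); rewrite quE qE; by rewrite -addrA [x0 *: b + _]addrC subrK.
by move/dimvS; rewrite dimU dim_vline; case: (b != 0).
Qed.

(** * Extremal examples *)

Section examples.
Variable R : realType.

Definition laurent n m (c : 'I_m -> R) (a : 'I_m -> 'rV[R]_n) (x : 'rV[R]_n) : R :=
  \sum_(i < m) c i * monomial (a i) x.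

Lemma laurent_repr n m (c : 'I_m -> R) (a : 'I_m -> 'rV[R]_n) :
  (forall i, c i != 0) -> injective a -> nomial_repr c a (laurent c a).
Proof. by move=> c0 inja; split. Qed.

(* x + y + 1/(xy) - 3 vanishes only at (1, 1), by AM-GM. *)
Definition point_coef (i : 'I_4) : R := nth 0 [:: 1; 1; 1; - 3] i.
Definition point_exp (i : 'I_4) : 'rV[R]_2 :=
  \row_j nth 0 (nth [::] [:: [:: 1; 0]; [:: 0; 1]; [:: - 1; - 1]; [:: 0; 0]] i) j.

Lemma point_repr : nomial_repr point_coef point_exp (laurent point_coef point_exp).
Proof.
apply: laurent_repr => [[[|[|[|[|//]]]] ?]|i j].
- by rewrite /point_coef /= oner_eq0.
- by rewrite /point_coef /= oner_eq0.
- by rewrite /point_coef /= oner_eq0.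
- by rewrite /point_coef /= oppr_eq0 pnatr_eq0.
move/rowP => ij; have := ij ord0; have := ij ord_max; rewrite !mxE.
case: i {ij} => [[|[|[|[|//]]]] ?]; case: j => [[|[|[|[|//]]]] ?] /= h1 h2;
  by [apply: val_inj|exfalso; lra].
Qed.

(** The equation reads exp(s) + exp(t) + exp(- s - t) = 3. The bounds exp(u) >= 1 + u add up to
    exactly 3 and are strict for nonzero u, which forces s = t = 0. *)
Lemma point_log_zeros : log_zeros point_coef point_exp = [set 0].
Proof.
apply/seteqP; split => y; rewrite /log_zeros /= /dot !big_ord_recl !big_ord0 /=;
  rewrite /point_coef /point_exp !mxE /=.
  set s := y ord0 ord0; set t := y ord0 (lift ord0 ord0) => e.
  have h : expR s + expR t + expR (- s - t) = 3.
    by move: e; rewrite !(mul1r, mul0r, add0r, addr0, mulN1r) expR0; lra.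
  have s0 : s = 0.
    apply: contrapT => /eqP s0; have := expR_gt1Dx s0.
    have := expR_ge1Dx t; have := expR_ge1Dx (- s - t); lra.
  have t0 : t = 0.
    apply: contrapT => /eqP t0; have := expR_gt1Dx t0.
    have := expR_ge1Dx s; have := expR_ge1Dx (- s - t); lra.
  apply/rowP => j; rewrite mxE; case: j => [[|[|//]] j2].
    by rewrite -[RHS]s0; congr (y _ _); exact: val_inj.
  by rewrite -[RHS]t0; congr (y _ _); exact: val_inj.
by move=> ->; rewrite !mxE !mulr0 !addr0 expR0; lra.
Qed.

Lemma Comp_point : (1%:R%:E <= Comp (zero_set (laurent point_coef point_exp)))%E.
Proof.
rewrite (zero_set_Exp point_repr) point_log_zeros image_set1.
set x0 := Exp 0.
apply: (@counting_ge R _ 1 (fun=> connected_component [set x0] x0)).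
  by move=> i j _; rewrite !ord1.
move=> _; split; first by exists x0.
rewrite /= (_ : connected_component _ _ = [set x0]); first exact: compact_set1.
apply/seteqP; split; first exact: connected_component_sub.
by move=> _ ->; exact: connected_component_refl.
Qed.

(* (x_1 - 1)(x_1 - 2)(x_1 - 3) *)
Definition planes_coef (i : 'I_4) : R := nth 0 [:: - 6; 11; - 6; 1] i.
Definition planes_exp n (i : 'I_4) : 'rV[R]_n.+1 := i%:R *: delta_mx ord0 ord0.

Lemma planes_repr n :
  nomial_repr planes_coef (@planes_exp n) (laurent planes_coef (@planes_exp n)).
Proof.
apply: laurent_repr => [[[|[|[|[|//]]]] ?]|i j].
- by rewrite /planes_coef /= oppr_eq0 pnatr_eq0.
- by rewrite /planes_coef /= pnatr_eq0.
- by rewrite /planes_coef /= oppr_eq0 pnatr_eq0.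
- by rewrite /planes_coef /= oner_eq0.
move/rowP => /(_ ord0); rewrite !mxE !eqxx !mulr1 => /eqP.
by rewrite eqr_nat => /eqP ij; exact: val_inj.
Qed.

Lemma planes_log_zeros n (y : 'rV[R]_n.+1) : log_zeros planes_coef (@planes_exp n) y <->
  [\/ expR (y ord0 ord0) = 1, expR (y ord0 ord0) = 2 | expR (y ord0 ord0) = 3].
Proof.
have dotE (i : 'I_4) : expR (dot (planes_exp n i) y) = expR (y ord0 ord0) ^+ i.
  rewrite -expRM_natl dotZl; congr (expR (_ * _)).
  rewrite /dot (bigD1 ord0) //= big1 ?addr0 ?mxE ?eqxx ?mul1r // => j j0.
  by rewrite mxE (negbTE j0) andbF mul0r.
rewrite /log_zeros /= !big_ord_recl big_ord0 !dotE /planes_coef /=.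
set u := expR _; split => [e|].
  have : (u - 1) * ((u - 2) * (u - 3)) = 0 by rewrite -[RHS]e /bump /=; ring.
  move/eqP; rewrite !mulf_eq0 !subr_eq0 => /or3P[] /eqP ->;
    by [constructor 1|constructor 2|constructor 3].
by rewrite /bump /=; case=> ->; ring.
Qed.

Let planes n := zero_set (laurent planes_coef (@planes_exp n)).

Let pt n (i : 'I_3) : 'rV[R]_n.+1 := Exp (const_mx (ln i.+1%:R)).

Let planes_pt n i : @planes n (pt n i).
Proof.
rewrite /planes (zero_set_Exp (@planes_repr n)); exists (const_mx (ln i.+1%:R)) => //.
apply/planes_log_zeros; rewrite mxE lnK ?posrE ?ltr0n //.
by case: i => [[|[|[|//]]] ?]; [constructor 1|constructor 2|constructor 3].
Qed.

Let planes_coord n x : @planes n x -> exists i : 'I_3, x ord0 ord0 = i.+1%:R.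
Proof.
rewrite /planes (zero_set_Exp (@planes_repr n)) => -[y /planes_log_zeros yZ <-].
rewrite mxE; case: yZ => ->.
- by exists ord0.
- by exists (@Ordinal 3 1 isT).
- by exists (@Ordinal 3 2 isT).
Qed.

Let planes_component n i : set 'rV[R]_n.+1 := connected_component (@planes n) (pt n i).

(** The first coordinate maps a component onto an interval. If two components coincided, it would
    contain [i.+1] and [j.+1] with i < j, hence also the half-integer just above [i.+1], but on the
    zero set this coordinate is 1, 2 or 3. *)
Let planes_component_inj n : injective (@planes_component n).
Proof.
suff lt_neq (i j : 'I_3) : (i < j)%N -> @planes_component n i <> @planes_component n j.
  move=> i j ij; apply: val_inj; have [lt|lt|//] := ltngtP i j.
    by case: (lt_neq _ _ lt).
  by case: (lt_neq _ _ lt).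
move=> ij e; pose p1 (x : 'rV[R]_n.+1) := x ord0 ord0.
have : connected (p1 @` @planes_component n i).
  apply: connected_continuous_connected; first exact: component_connected.
  by apply: continuous_subspaceT; exact: coord_continuous.
move/connected_intervalP => itv.
have p1pt k : p1 (pt n k) = k.+1%:R by rewrite /p1 !mxE lnK // posrE ltr0n.
have ii : (p1 @` @planes_component n i) i.+1%:R.
  by exists (pt n i) => //; exact: connected_component_refl.
have jj : (p1 @` @planes_component n i) j.+1%:R.
  by exists (pt n j) => //; rewrite e; exact: connected_component_refl.
have [|x] := itv _ _ ii jj (i.+1%:R + 2^-1).
  have : (i.+2%:R <= j.+1%:R :> R) by rewrite ler_nat.
  by rewrite -[i.+2%:R]natr1; lra.
move=> /connected_component_sub /planes_coord[k xk]; rewrite /p1 xk => /eqP.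
have [ki|ik] := leqP k i.
  have : (k.+1%:R <= i.+1%:R :> R) by rewrite ler_nat.
  by move=> h /eqP; lra.
have : (i.+2%:R <= k.+1%:R :> R) by rewrite ler_nat.
by rewrite -[i.+2%:R]natr1 => h /eqP; lra.
Qed.

Lemma Tot_planes n : (3%:R%:E <= Tot (zero_set (laurent planes_coef (@planes_exp n))))%E.
Proof.
apply: (@counting_ge _ _ _ (@planes_component n)); first exact: planes_component_inj.
by move=> i; exists (pt n i) => //; exact: planes_pt.
Qed.

Lemma Non_planes : (3%:R%:E <= Non (zero_set (laurent planes_coef (@planes_exp 1))))%E.
Proof.
apply: (@counting_ge _ _ _ (@planes_component 1)); first exact: planes_component_inj.
move=> i; split; first by exists (pt 1 i) => //; exact: planes_pt.
(* In logarithmic coordinates the component contains this whole line, on which the second coordinate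
   is unbounded. *)
pose Z := [set y : 'rV[R]_2 | y ord0 ord0 = ln i.+1%:R].
have ZC : (@Exp R 2) @` Z `<=` @planes_component 1 i.
  apply: connected_component_max.
  - by exists (const_mx (ln i.+1%:R)) => //; rewrite /Z /= mxE.
  - move=> _ [y yZ <-]; rewrite /planes (zero_set_Exp (@planes_repr 1)); exists y => //.
    apply/planes_log_zeros; rewrite yZ lnK ?posrE ?ltr0n //.
    by case: i {yZ Z} => [[|[|[|//]]] ?]; [constructor 1|constructor 2|constructor 3].
  apply: Exp_connected; apply: seg_convex_connected => x y t; rewrite /Z /= !mxE => -> -> _ _.
  by rewrite subrr mulr0 addr0.
apply: unbounded_not_compact ZC; first by move=> x /connected_component_sub [].
exists (delta_mx ord0 ord_max) => M.
exists (\row_j if j == ord0 then ln i.+1%:R else M + 1); first by rewrite /Z /= mxE.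
rewrite /dot !big_ord_recl big_ord0 !mxE /= mul0r add0r addr0 mul1r.
by rewrite (lt_le_trans _ (ler_norm _)) // ltrDl.
Qed.

End examples.

Theorem theorem4 (R : realType) :
  [/\ is_Pcomp R 2 4 1,
      is_Pnon R 2 4 3,
      is_P R 2 4 3 /\ (forall n : nat, (0 < n)%N -> is_P R n 4 3)
    & forall (f : 'rV[R]_2 -> R) (c : 'I_4 -> R) (a : 'I_4 -> 'rV[R]_2),
        nomial_repr c a f -> has_dim (Newt a) 2 ->
        (Tot (zero_set f) <= 2%:R%:E)%E].
Proof.
have PE (n : nat) : (0 < n)%N -> is_P R n 4 3.
  case: n => // n _; split; last by move=> _ [f fO <-]; exact: Tot_Omega.
  have fO : Omega 4 (laurent (planes_coef R) (@planes_exp R n)).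
    by exists 4%N => //; exists (planes_coef R), (@planes_exp R n); exact: planes_repr.
  by exists (laurent (planes_coef R) (@planes_exp R n)) => //;
    apply/eqP; rewrite eq_le Tot_planes Tot_Omega.
split.
- split; last by move=> _ [f fO <-]; exact: Comp_Omega.
  have fO : Omega 4 (laurent (point_coef R) (point_exp R)).
    by exists 4%N => //; exists (point_coef R), (point_exp R); exact: point_repr.
  by exists (laurent (point_coef R) (point_exp R)) => //;
    apply/eqP; rewrite eq_le Comp_point Comp_Omega.
- have Non3 f : @Omega R 2 4 f -> (Non (zero_set f) <= 3%:R%:E)%E.
    by move=> fO; exact: le_trans (Non_le_Tot _) (Tot_Omega fO).
  split; last by move=> _ [f fO <-]; exact: Non3.
  have fO : Omega 4 (laurent (planes_coef R) (@planes_exp R 1)).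
    by exists 4%N => //; exists (planes_coef R), (@planes_exp R 1); exact: planes_repr.
  by exists (laurent (planes_coef R) (@planes_exp R 1)) => //;
    apply/eqP; rewrite eq_le Non_planes Non3.
- by split => //; exact: PE.
- move=> f c a ff dim2; exact: (Tot_not_collinear (leqnn 4) ff (dim2_not_collinear dim2)).
Qed.
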